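(* $\mathsf{RCA}_0^{\ast}$ proves: for all $a,c\in\mathbb{N}$ and all $f\colon\mathbb{N}\to\mathbb{N}$, $$R^f_c(a)=D^f_c(a)+a$$ (one side being defined if and only if the other is).
   Context: $\mathsf{RCA}_0^{\ast}$ is the subsystem of second order arithmetic, in the usual language augmented by a binary function symbol $\exp$ (written $m^n$), whose axioms are: the basic axioms of second order arithmetic (the usual quantifier-free axioms for $0,1,+,\cdot,<$); the exponentiation axioms $m^0=1$, $m^{n+1}=m\cdot m^n$; the induction scheme for all $\Sigma^0_0$ formulas (possibly containing $\exp$); and the comprehension scheme for all $\Delta^0_1$ formulas (possibly containing $\exp$). $\mathbb{N}$ is the set of nonnegative integers, and $c\in\mathbb{N}$ is identified with $\{0,\dots,c-1\}$. For $a,R\in\mathbb{N}$, $[a,R]=\{n\in\mathbb{N}:a\le n\le R\}$ and $[a,R]^2=\{(n,m)\in\mathbb{N}^2:a\le n<m\le R\}$. For a coloring $C\colon[a,R]^2\to c$, a set $H=\{h_0<h_1<\cdots\}\subseteq[a,R]$ is $C$-weakly homogeneous if $C(h_i,h_{i+1})=C(h_{i+1},h_{i+2})$ for all $h_i,h_{i+1},h_{i+2}\in H$. $\mathrm{WPH}^f_c(a,R)$ states: for every coloring $C\colon[a,R]^2\to c$ there is a (nonempty) $C$-weakly homogeneous set $H\subseteq[a,R]$ with $|H|>f(\min H)$. For $\overline{m},\overline{n}\in\mathbb{N}^c$, $\overline{m}\le\overline{n}$ means $m_k\le n_k$ for all $k<c$, and $|\overline{m}|_\infty=\max_{k<c}m_k$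 (with value $0$ if $c=0$). $\mathrm{MDL}^f_c(a,D)$ states: for every sequence $\overline{m}_0,\dots,\overline{m}_D\in\mathbb{N}^c$ with $|\overline{m}_i|_\infty<f(a+i)$ for all $i\le D$ there exist $i<j\le D$ with $\overline{m}_i\le\overline{m}_j$. $R^f_c(a)$ is the smallest $R$ such that $\mathrm{WPH}^f_c(a,R)$ holds, and $D^f_c(a)$ is the smallest $D$ such that $\mathrm{MDL}^f_c(a,D)$ holds. *)

(* Defs.v *)
From Stdlib Require Import List.

(** De Bruijn indices, with independent index spaces for number variables
    and set variables. *)

Inductive term : Type :=
| Var (n : nat)
| Zero
| One
| Add (t u : term)
| Mul (t u : term)
| Exp (t u : term).

(** Equality of sets is not primitive: it is extensional equality, as usual in
    second order arithmetic. *)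
Inductive formula : Type :=
| Bot
| Eq (t u : term)
| Lt (t u : term)
| Mem (t : term) (X : nat)
| Imp (p q : formula)
| AllN (p : formula)
| AllS (p : formula).

Definition Neg p := Imp p Bot.
Definition Top := Neg Bot.
Definition And p q := Neg (Imp p (Neg q)).
Definition Or p q := Imp (Neg p) q.
Definition Iff p q := And (Imp p q) (Imp q p).
Definition ExN p := Neg (AllN (Neg p)).
Definition ExS p := Neg (AllS (Neg p)).

Fixpoint tsubst (s : nat -> term) (t : term) : term :=
  match t with
  | Var n => s n
  | Zero => Zero
  | One => One
  | Add t u => Add (tsubst s t) (tsubst s u)
  | Mul t u => Mul (tsubst s t) (tsubst s u)
  | Exp t u => Exp (tsubst s t) (tsubst s u)
  end.

Definition scons {A : Type} (a : A) (s : nat -> A) (n : nat) : A :=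
  match n with O => a | S n => s n end.

Definition tlift : term -> term := tsubst (fun n => Var (S n)).

(** The only set terms are set variables, so sets are substituted by renaming. *)
Fixpoint fsubst (s : nat -> term) (r : nat -> nat) (p : formula) : formula :=
  match p with
  | Bot => Bot
  | Eq t u => Eq (tsubst s t) (tsubst s u)
  | Lt t u => Lt (tsubst s t) (tsubst s u)
  | Mem t X => Mem (tsubst s t) (r X)
  | Imp p q => Imp (fsubst s r p) (fsubst s r q)
  | AllN p => AllN (fsubst (scons (Var 0) (fun n => tlift (s n))) r p)
  | AllS p => AllS (fsubst s (scons 0 (fun n => S (r n))) p)
  end.

Definition substN (t : term) (p : formula) : formula :=
  fsubst (scons t Var) (fun X => X) p.
Definition substS (Y : nat) (p : formula) : formula :=
  fsubst Var (scons Y (fun X => X)) p.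
Definition liftN (p : formula) : formula :=
  fsubst (fun n => Var (S n)) (fun X => X) p.
Definition liftS (p : formula) : formula := fsubst Var S p.

(** Classical natural deduction.  Members of [T] may have free variables and
    stand for their universal closures: [AllNI] and [AllSI] put the eigenvariable
    condition on the context only. *)
Inductive derives (T : formula -> Prop) : list formula -> formula -> Prop :=
| Ax G p : T p -> derives T G p
| Hyp G p : In p G -> derives T G p
| ImpI G p q : derives T (p :: G) q -> derives T G (Imp p q)
| ImpE G p q : derives T G (Imp p q) -> derives T G p -> derives T G q
| RAA G p : derives T (Neg p :: G) Bot -> derives T G p
| AllNI G p : derives T (map liftN G) p -> derives T G (AllN p)
| AllNE G p t : derives T G (AllN p) -> derives T G (substN t p)
| AllSI G p : derives T (map liftS G) p -> derives T G (AllS p)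
| AllSE G p Y : derives T G (AllS p) -> derives T G (substS Y p)
| EqRefl G t : derives T G (Eq t t)
| EqSubst G p t u :
    derives T G (Eq t u) -> derives T G (substN t p) -> derives T G (substN u p).

Definition proves (T : formula -> Prop) (p : formula) : Prop := derives T nil p.

Notation "T ⊢ p" := (proves T p) (at level 70, no associativity).

(** A named-variable syntax for closed formulas: a [tm], [sv] or
    [fm] is a term, set variable or formula awaiting the number of number and
    set quantifiers it occurs under.  A bound variable is
    represented by its de Bruijn level, which is converted to an index at each
    occurrence, so binders can be written as Rocq functions. *)

Declare Scope tm_scope.
Declare Scope fm_scope.
Delimit Scope tm_scope with tm.
Delimit Scope fm_scope with fm.

Definition tm : Type := nat -> term.
Definition sv : Type := nat -> nat.
Definition fm : Type := nat -> nat -> formula.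
Bind Scope tm_scope with tm.
Bind Scope fm_scope with fm.

Definition sentence (p : fm) : formula := p 0 0.

Definition tzero : tm := fun _ => Zero.
Definition tone : tm := fun _ => One.
Definition tadd (t u : tm) : tm := fun d => Add (t d) (u d).
Definition tmul (t u : tm) : tm := fun d => Mul (t d) (u d).
Definition texp (t u : tm) : tm := fun d => Exp (t d) (u d).

Definition fbot : fm := fun _ _ => Bot.
Definition ftop : fm := fun _ _ => Top.
Definition feq (t u : tm) : fm := fun d _ => Eq (t d) (u d).
Definition flt (t u : tm) : fm := fun d _ => Lt (t d) (u d).
Definition fmem (t : tm) (X : sv) : fm := fun d e => Mem (t d) (X e).
Definition fimp (p q : fm) : fm := fun d e => Imp (p d e) (q d e).
Definition fneg (p : fm) : fm := fun d e => Neg (p d e).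
Definition fand (p q : fm) : fm := fun d e => And (p d e) (q d e).
Definition for_ (p q : fm) : fm := fun d e => Or (p d e) (q d e).
Definition fiff (p q : fm) : fm := fun d e => Iff (p d e) (q d e).

Definition nlevel (l : nat) : tm := fun d => Var (d - S l).
Definition slevel (l : nat) : sv := fun e => e - S l.

Definition fallN (P : tm -> fm) : fm := fun d e => AllN (P (nlevel d) (S d) e).
Definition fexN (P : tm -> fm) : fm := fun d e => ExN (P (nlevel d) (S d) e).
Definition fallS (P : sv -> fm) : fm := fun d e => AllS (P (slevel e) d (S e)).
Definition fexS (P : sv -> fm) : fm := fun d e => ExS (P (slevel e) d (S e)).

Notation "0" := tzero : tm_scope.
Notation "1" := tone : tm_scope.
Infix "+" := tadd : tm_scope.
Infix "*" := tmul : tm_scope.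
Infix "^" := texp : tm_scope.
Notation "⊥" := fbot : fm_scope.
Notation "⊤" := ftop : fm_scope.
Infix "=" := feq : fm_scope.
Infix "<" := flt : fm_scope.
Notation "t ∈ X" := (fmem t X) (at level 70, no associativity) : fm_scope.
Notation "¬ p" := (fneg p) (at level 75, right associativity) : fm_scope.
Notation "p ∧ q" := (fand p q) (at level 80, right associativity) : fm_scope.
Notation "p ∨ q" := (for_ p q) (at level 85, right associativity) : fm_scope.
Notation "p → q" := (fimp p q)
  (at level 99, q at level 200, right associativity) : fm_scope.
Notation "p ↔ q" := (fiff p q) (at level 95, no associativity) : fm_scope.
Notation "∀ x .. y , p" := (fallN (fun x => .. (fallN (fun y => p%fm)) ..))
  (at level 200, x binder, y binder, right associativity) : fm_scope.
Notation "∃ x .. y , p" := (fexN (fun x => .. (fexN (fun y => p%fm)) ..))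
  (at level 200, x binder, y binder, right associativity) : fm_scope.
Notation "∀² X .. Y , p" := (fallS (fun X => .. (fallS (fun Y => p%fm)) ..))
  (at level 200, X binder, Y binder, right associativity) : fm_scope.
Notation "∃² X .. Y , p" := (fexS (fun X => .. (fexS (fun Y => p%fm)) ..))
  (at level 200, X binder, Y binder, right associativity) : fm_scope.

Local Open Scope fm_scope.

Inductive basic_axiom : formula -> Prop :=
| succ_neq0 : basic_axiom (sentence (∀ n, ¬ n + 1 = 0))
| succ_inj : basic_axiom (sentence (∀ m n, m + 1 = n + 1 → m = n))
| add_0 : basic_axiom (sentence (∀ m, m + 0 = m))
| add_succ : basic_axiom (sentence (∀ m n, m + (n + 1) = (m + n) + 1))
| mul_0 : basic_axiom (sentence (∀ m, m * 0 = 0))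
| mul_succ : basic_axiom (sentence (∀ m n, m * (n + 1) = m * n + m))
| lt_0 : basic_axiom (sentence (∀ m, ¬ m < 0))
| lt_succ : basic_axiom (sentence (∀ m n, m < n + 1 ↔ (m < n ∨ m = n))).

Inductive exp_axiom : formula -> Prop :=
| exp_0 : exp_axiom (sentence (∀ m, m ^ 0 = 1))
| exp_succ : exp_axiom (sentence (∀ m n, m ^ (n + 1) = m * m ^ n)).

(** The bounding term is lifted, so it cannot contain the bounded variable.
    The defined connectives need no clauses of their own, but a bounded [ExN]
    does, as it does not unfold to a bounded [AllN]. *)
Inductive Sigma00 : formula -> Prop :=
| Sigma00_Bot : Sigma00 Bot
| Sigma00_Eq t u : Sigma00 (Eq t u)
| Sigma00_Lt t u : Sigma00 (Lt t u)
| Sigma00_Mem t X : Sigma00 (Mem t X)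
| Sigma00_Imp p q : Sigma00 p -> Sigma00 q -> Sigma00 (Imp p q)
| Sigma00_All t p : Sigma00 p -> Sigma00 (AllN (Imp (Lt (Var 0) (tlift t)) p))
| Sigma00_Ex t p : Sigma00 p -> Sigma00 (ExN (And (Lt (Var 0) (tlift t)) p)).

Definition Sigma01 (p : formula) : Prop := exists q, Sigma00 q /\ p = ExN q.
Definition Pi01 (p : formula) : Prop := exists q, Sigma00 q /\ p = AllN q.

(** The induction variable is number variable 0 of [p]. *)
Definition induction (p : formula) : formula :=
  let p_succ :=
    fsubst (scons (Add (Var 0) One) (fun n => Var (S n))) (fun X => X) p in
  Imp (And (substN Zero p) (AllN (Imp p p_succ))) (AllN p).

(** [p] and [q] define the same set of values of number variable 0. *)
Definition comprehension (p q : formula) : formula :=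
  Imp (AllN (Iff p q)) (ExS (AllN (Iff (Mem (Var 0) 0) (liftS p)))).

Inductive RCA0star : formula -> Prop :=
| RCA0star_basic p : basic_axiom p -> RCA0star p
| RCA0star_exp p : exp_axiom p -> RCA0star p
| RCA0star_induction p : Sigma00 p -> RCA0star (induction p)
| RCA0star_comprehension p q : Sigma01 p -> Pi01 q -> RCA0star (comprehension p q).

Definition fle (t u : tm) : fm := t < u ∨ t = u.
Infix "≤" := fle (at level 70, no associativity) : fm_scope.

Definition fexN1 (P : tm -> fm) : fm := ∃ y, P y ∧ ∀ z, P z → z = y.
Notation "∃! x , p" := (fexN1 (fun x => p%fm))
  (at level 200, x name, right associativity) : fm_scope.

(** Simpson's pairing (t + u)^2 + t. *)
Definition tpair (t u : tm) : tm := ((t + u) * (t + u) + t)%tm.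
Notation "⟨ t , u ⟩" := (tpair t u) : tm_scope.

(** [F] is a function from the class [A] to the class [B], that is, a
    single-valued total subset of A × B. *)
Definition is_fun (F : sv) (A B : tm -> fm) : fm :=
  (∀ p, p ∈ F → ∃ x y, p = ⟨x, y⟩ ∧ A x ∧ B y) ∧
  (∀ x, A x → ∃! y, ⟨x, y⟩ ∈ F).

Definition app_eq (F : sv) (x y : tm) : fm := ⟨x, y⟩ ∈ F.
Notation "F ⟦ x ⟧ == y" := (app_eq F x y)
  (at level 70, x at level 200, y at next level, no associativity) : fm_scope.

Definition cN : tm -> fm := fun _ => ⊤.
Definition below (c : tm) : tm -> fm := fun x => x < c.
Definition mem (X : sv) : tm -> fm := fun x => x ∈ X.
Definition interval (a R : tm) : tm -> fm := fun n => a ≤ n ∧ n ≤ R.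

(** [a,R]^2 *)
Definition pairs (a R : tm) : tm -> fm :=
  fun p => ∃ n m, p = ⟨n, m⟩ ∧ a ≤ n ∧ n < m ∧ m ≤ R.

(** {0,...,D} × {0,...,c-1} *)
Definition grid (D c : tm) : tm -> fm :=
  fun p => ∃ i k, p = ⟨i, k⟩ ∧ i ≤ D ∧ k < c.

(** [h] enumerates [H] as h_0 < ... < h_{k-1}; in particular |H| = k. *)
Definition enumerates (h H : sv) (k : tm) : fm :=
  is_fun h (below k) (mem H) ∧
  (∀ i j x y, i < j → h⟦i⟧ == x → h⟦j⟧ == y → x < y) ∧
  (∀ x, x ∈ H → ∃ i, h⟦i⟧ == x).

Definition is_min (H : sv) (m : tm) : fm := m ∈ H ∧ ∀ x, x ∈ H → m ≤ x.

Definition is_least (P : tm -> fm) (n : tm) : fm := P n ∧ ∀ m, m < n → ¬ P m.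

Definition weakly_homogeneous (C h : sv) : fm :=
  ∀ i x y z, h⟦i⟧ == x → h⟦i + 1⟧ == y → h⟦i + 1 + 1⟧ == z →
    ∃ v, C⟦⟨x, y⟩⟧ == v ∧ C⟦⟨y, z⟩⟧ == v.

(** Nonemptiness of [H] is implied by the existence of its minimum. *)
Definition WPH (f : sv) (c a R : tm) : fm :=
  ∀² C, is_fun C (pairs a R) (below c) →
    ∃² H h, ∃ k m y,
      (∀ x, x ∈ H → interval a R x) ∧
      enumerates h H k ∧
      weakly_homogeneous C h ∧
      is_min H m ∧ f⟦m⟧ == y ∧ y < k.

Definition is_R (f : sv) (c a R : tm) : fm := is_least (WPH f c a) R.

(** A sequence m_0,...,m_D of elements of N^c is a function
    M : {0,...,D} × {0,...,c-1} -> N, where M(i,k) is the k-th entry of m_i. *)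

Definition is_norm (M : sv) (c i y : tm) : fm :=
  (∀ k x, k < c → M⟦⟨i, k⟩⟧ == x → x ≤ y) ∧
  ((c = 0 ∧ y = 0) ∨ ∃ k, k < c ∧ M⟦⟨i, k⟩⟧ == y).

Definition entrywise_le (M : sv) (c i j : tm) : fm :=
  ∀ k x y, k < c → M⟦⟨i, k⟩⟧ == x → M⟦⟨j, k⟩⟧ == y → x ≤ y.

Definition MDL (f : sv) (c a D : tm) : fm :=
  ∀² M, is_fun M (grid D c) cN →
    (∀ i, i ≤ D → ∃ y z, is_norm M c i y ∧ f⟦a + i⟧ == z ∧ y < z) →
    ∃ i j, i < j ∧ j ≤ D ∧ entrywise_le M c i j.

Definition is_D (f : sv) (c a D : tm) : fm := is_least (MDL f c a) D.

(* Main.v *)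
(** By the completeness theorem for two-sorted classical logic it suffices to
    argue in an arbitrary model of RCA_0^*.  There one
    shows that WPH(a, a+D) and MDL(a, D) are equivalent for each D, and that
    WPH(a, R) fails for R < a.

    Given vectors m_0, ..., m_D without i < j and m_i <= m_j, color (a+i, a+j)
    by the least k where m_i exceeds m_j.  Along a weakly homogeneous set H of
    color k the k-th entries decrease strictly, so |H| is at most 1 plus the
    k-th entry at min H.  Conversely, given a coloring, let the k-th entry of
    m_i be the largest number of edges of a path of color k that starts at a+i; an
    edge of color k from a+i to a+j shows that the k-th entry of m_i exceeds
    that of m_j.  Paths are coded by their digits in base a+D+1, so that
    prepending x to the path coded by p gives x + (a+D+1) p, and the code of a
    path with l edges is below (a+D+1)^(l+1).

    The coloring and the sequence have to be obtained by Delta-0-1 comprehension, for which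
    the values of f on [a, a+D] must be bounded. *)

From Stdlib Require Import List Arith Lia Cantor Classical ClassicalEpsilon Ring.
From Stdlib Require Import FunctionalExtensionality PropExtensionality ProofIrrelevance.
Require Import Defs.

(** * Substitution *)

Notation up s := (scons (Var 0) (fun n => tlift (s n))).
Notation upS r := (scons 0 (fun n => S (r n))).

Lemma scons_ext {A : Type} (a : A) (s s' : nat -> A) :
  s 0 = a -> (forall n, s (S n) = s' n) -> s = scons a s'.
Proof.
  intros H0 HS; apply functional_extensionality; intros [|n]; simpl; auto.
Qed.

Lemma tsubst_tsubst s s' t :
  tsubst s (tsubst s' t) = tsubst (fun n => tsubst s (s' n)) t.
Proof. induction t; simpl; congruence. Qed.

Lemma tsubst_Var t : tsubst Var t = t.
Proof. induction t; simpl; congruence. Qed.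

Lemma fsubst_fsubst s r s' r' p :
  fsubst s r (fsubst s' r' p) =
  fsubst (fun n => tsubst s (s' n)) (fun X => r (r' X)) p.
Proof.
  revert s r s' r'; induction p; intros; simpl; rewrite ?tsubst_tsubst, ?IHp1, ?IHp2;
    try congruence.
  - rewrite IHp; do 2 f_equal; apply scons_ext; [reflexivity|]; intro n; simpl.
    unfold tlift; now rewrite !tsubst_tsubst.
  - rewrite IHp; do 2 f_equal; apply scons_ext; reflexivity.
Qed.

Lemma fsubst_Var p : fsubst Var (fun X => X) p = p.
Proof.
  induction p; simpl; rewrite ?tsubst_Var; try congruence.
  - rewrite <- (scons_ext (Var 0) Var) by reflexivity; congruence.
  - rewrite <- (scons_ext 0 (fun X => X)) by reflexivity; congruence.
Qed.

Lemma fsubst_substN s r t p :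
  fsubst s r (substN t p) = substN (tsubst s t) (fsubst (up s) r p).
Proof.
  unfold substN; rewrite !fsubst_fsubst; f_equal.
  apply functional_extensionality; intros [|n]; simpl; [reflexivity|].
  unfold tlift; rewrite tsubst_tsubst; simpl; now rewrite tsubst_Var.
Qed.

Lemma fsubst_substS s r Y p :
  fsubst s r (substS Y p) = substS (r Y) (fsubst s (upS r) p).
Proof.
  unfold substS; rewrite !fsubst_fsubst; f_equal.
  - apply functional_extensionality; intro n; simpl; now rewrite tsubst_Var.
  - apply functional_extensionality; intros [|n]; reflexivity.
Qed.

Lemma fsubst_up s r t p :
  substN t (fsubst (up s) r p) = fsubst (scons t s) r p.
Proof.
  unfold substN; rewrite fsubst_fsubst; f_equal.
  apply functional_extensionality; intros [|n]; simpl; [reflexivity|].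
  unfold tlift; rewrite tsubst_tsubst; simpl; apply tsubst_Var.
Qed.

Lemma fsubst_upS s r Y p :
  substS Y (fsubst s (upS r) p) = fsubst s (scons Y r) p.
Proof.
  unfold substS; rewrite fsubst_fsubst; f_equal.
  - apply functional_extensionality; intro n; apply tsubst_Var.
  - apply functional_extensionality; intros [|n]; reflexivity.
Qed.

Lemma fsubst_liftN s r p : fsubst (up s) r (liftN p) = liftN (fsubst s r p).
Proof. unfold liftN; rewrite !fsubst_fsubst; reflexivity. Qed.

Lemma fsubst_liftS s r p : fsubst s (upS r) (liftS p) = liftS (fsubst s r p).
Proof.
  unfold liftS; rewrite !fsubst_fsubst; f_equal.
  apply functional_extensionality; intro n; symmetry; apply tsubst_Var.
Qed.

(** Only finitely many variables occur in a term, a formula or a context. These supports provide the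
    fresh variables of [generalizeN] and [generalizeS]. *)
Lemma tsubst_support t : exists n, forall s s',
  (forall i, i < n -> s i = s' i) -> tsubst s t = tsubst s' t.
Proof.
  induction t as [m| | |t [n1 H1] u [n2 H2]|t [n1 H1] u [n2 H2]|t [n1 H1] u [n2 H2]];
    try (exists 0; reflexivity);
    try (exists (n1 + n2); intros s s' H; simpl; f_equal;
         [apply H1|apply H2]; intros; apply H; lia).
  exists (S m); intros s s' H; simpl; apply H; lia.
Qed.

Lemma fsubst_support p : exists n, forall s s' r r',
  (forall i, i < n -> s i = s' i) -> (forall i, i < n -> r i = r' i) ->
  fsubst s r p = fsubst s' r' p.
Proof.
  induction p as [|t u|t u|t X|p [n1 H1] q [n2 H2]|p [n H]|p [n H]].
  - exists 0; reflexivity.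
  - destruct (tsubst_support t) as [n1 H1], (tsubst_support u) as [n2 H2].
    exists (n1 + n2); intros s s' r r' H _; simpl; f_equal;
      [apply H1|apply H2]; intros; apply H; lia.
  - destruct (tsubst_support t) as [n1 H1], (tsubst_support u) as [n2 H2].
    exists (n1 + n2); intros s s' r r' H _; simpl; f_equal;
      [apply H1|apply H2]; intros; apply H; lia.
  - destruct (tsubst_support t) as [n1 H1].
    exists (n1 + S X); intros s s' r r' H H'; simpl; f_equal;
      [apply H1; intros; apply H; lia|apply H'; lia].
  - exists (n1 + n2); intros s s' r r' H H'; simpl; f_equal;
      [apply H1|apply H2]; intros; try apply H; try apply H'; lia.
  - exists n; intros s s' r r' Hs Hr; simpl; f_equal; apply H; auto.
    intros [|i] Hi; simpl; [reflexivity|]; rewrite Hs by lia; reflexivity.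
  - exists n; intros s s' r r' Hs Hr; simpl; f_equal; apply H; auto.
    intros [|i] Hi; simpl; [reflexivity|]; rewrite Hr by lia; reflexivity.
Qed.

Lemma context_support G : exists n, forall s s' r r',
  (forall i, i < n -> s i = s' i) -> (forall i, i < n -> r i = r' i) ->
  map (fsubst s r) G = map (fsubst s' r') G.
Proof.
  induction G as [|p G [n H]]; [exists 0; reflexivity|].
  destruct (fsubst_support p) as [m Hm].
  exists (n + m); intros s s' r r' Hs Hr; simpl; f_equal;
    [apply Hm|apply H]; intros; try apply Hs; try apply Hr; lia.
Qed.

(** * Coding of terms and formulas by numbers *)

Fixpoint tcode (t : term) : nat :=
  match t with
  | Var n => to_nat (0, n)
  | Zero => to_nat (1, 0)
  | One => to_nat (2, 0)
  | Add t u => to_nat (3, to_nat (tcode t, tcode u))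
  | Mul t u => to_nat (4, to_nat (tcode t, tcode u))
  | Exp t u => to_nat (5, to_nat (tcode t, tcode u))
  end.

Fixpoint fcode (p : formula) : nat :=
  match p with
  | Bot => to_nat (0, 0)
  | Eq t u => to_nat (1, to_nat (tcode t, tcode u))
  | Lt t u => to_nat (2, to_nat (tcode t, tcode u))
  | Mem t X => to_nat (3, to_nat (tcode t, X))
  | Imp p q => to_nat (4, to_nat (fcode p, fcode q))
  | AllN p => to_nat (5, fcode p)
  | AllS p => to_nat (6, fcode p)
  end.

Ltac code_inj :=
  repeat match goal with
  | H : to_nat _ = to_nat _ |- _ => apply to_nat_inj in H
  | H : (_, _) = (_, _) |- _ => apply pair_equal_spec in H; destruct H
  end.

Lemma tcode_inj t u : tcode t = tcode u -> t = u.
Proof.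
  revert u; induction t; intros [] H; cbn [tcode] in H; code_inj;
    try discriminate; f_equal; auto.
Qed.

Lemma fcode_inj p q : fcode p = fcode q -> p = q.
Proof.
  revert q; induction p; intros [] H; cbn [fcode] in H; code_inj;
    try discriminate; f_equal; auto using tcode_inj.
Qed.

(** Axioms may have free variables that stand for universally quantified ones, so a derivation can
    be substituted into only if substitution instances of axioms are again axioms. *)
Definition subst_closed (T : formula -> Prop) : Prop :=
  forall p s r, T p -> T (fsubst s r p).

Lemma derives_subst T G p s r :
  subst_closed T -> derives T G p ->
  derives T (map (fsubst s r) G) (fsubst s r p).
Proof.
  intros HT H; revert s r.
  induction H; intros s r; simpl in *.
  - apply Ax; auto.
  - apply Hyp; now apply in_map.
  - apply ImpI; auto.
  - eapply ImpE; eauto.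
  - apply RAA; apply (IHderives s r).
  - apply AllNI; rewrite map_map.
    specialize (IHderives (up s) r); rewrite map_map in IHderives.
    erewrite map_ext; [exact IHderives|]; intro; symmetry; apply fsubst_liftN.
  - rewrite fsubst_substN; apply AllNE; apply IHderives.
  - apply AllSI; rewrite map_map.
    specialize (IHderives s (upS r)); rewrite map_map in IHderives.
    erewrite map_ext; [exact IHderives|]; intro; symmetry; apply fsubst_liftS.
  - rewrite fsubst_substS; apply AllSE; apply IHderives.
  - apply EqRefl.
  - rewrite fsubst_substN; eapply EqSubst; [apply IHderives1|].
    rewrite <- fsubst_substN; apply IHderives2.
Qed.

Lemma derives_weaken T G G' p :
  derives T G p -> incl G G' -> derives T G' p.
Proof.
  intros H; revert G'; induction H; intros G' Hi.
  - now apply Ax.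
  - apply Hyp; auto.
  - apply ImpI; apply IHderives; intros x [->|Hx]; [left|right]; auto.
  - eapply ImpE; eauto.
  - apply RAA; apply IHderives; intros x [->|Hx]; [left|right]; auto.
  - apply AllNI; apply IHderives; now apply incl_map.
  - apply AllNE; auto.
  - apply AllSI; apply IHderives; now apply incl_map.
  - apply AllSE; auto.
  - apply EqRefl.
  - eapply EqSubst; eauto.
Qed.

(** A variable [x] beyond the supports of [G] and [q] acts as an eigenvariable: sending [x] to index
    0 and raising every other index by one turns the given derivation into one of [q] from the
    lifted context, as [AllNI] requires. As [x] does not depend on the derivation, it can serve as a
    Henkin witness. *)
Lemma generalizeN T G q : subst_closed T -> exists x,
  derives T G (substN (Var x) q) -> derives T G (AllN q).
Proof.
  intros HT.
  destruct (context_support G) as [n Hn], (fsubst_support q) as [m Hm].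
  exists (n + m); intros H; apply AllNI.
  set (s := fun i => if Nat.eq_dec i (n + m) then Var 0 else Var (S i)).
  apply derives_subst with (s := s) (r := fun X => X) in H; [|exact HT].
  unfold substN in H; rewrite fsubst_fsubst in H.
  rewrite (Hn s (fun i => Var (S i)) _ (fun X => X)) in H; [|intros i Hi|reflexivity].
  2:{ unfold s; destruct Nat.eq_dec; [lia|reflexivity]. }
  rewrite (Hm _ Var _ (fun X => X)), fsubst_Var in H; [exact H| |reflexivity].
  intros [|i] Hi; simpl; unfold s; destruct Nat.eq_dec; try lia; reflexivity.
Qed.

Lemma generalizeS T G q : subst_closed T -> exists Y,
  derives T G (substS Y q) -> derives T G (AllS q).
Proof.
  intros HT.
  destruct (context_support G) as [n Hn], (fsubst_support q) as [m Hm].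
  exists (n + m); intros H; apply AllSI.
  set (r := fun i => if Nat.eq_dec i (n + m) then 0 else S i).
  apply derives_subst with (s := Var) (r := r) in H; [|exact HT].
  unfold substS in H; rewrite fsubst_fsubst in H.
  rewrite (Hn Var Var r S) in H; [|reflexivity|intros i Hi].
  2:{ unfold r; destruct Nat.eq_dec; [lia|reflexivity]. }
  rewrite (Hm _ Var _ (fun X => X)), fsubst_Var in H; [exact H|reflexivity|].
  intros [|i] Hi; simpl; unfold r; destruct Nat.eq_dec; try lia; reflexivity.
Qed.

(** * Completeness *)

Record structure : Type := Structure {
  dom : Type;
  sets : Type;
  zero : dom;
  one : dom;
  add : dom -> dom -> dom;
  mul : dom -> dom -> dom;
  exp : dom -> dom -> dom;
  lt : dom -> dom -> Prop;
  el : dom -> sets -> Prop }.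

Fixpoint teval (M : structure) (e : nat -> dom M) (t : term) : dom M :=
  match t with
  | Var n => e n
  | Zero => zero M
  | One => one M
  | Add t u => add M (teval M e t) (teval M e u)
  | Mul t u => mul M (teval M e t) (teval M e u)
  | Exp t u => exp M (teval M e t) (teval M e u)
  end.

Fixpoint eval (M : structure) (e : nat -> dom M) (v : nat -> sets M)
    (p : formula) : Prop :=
  match p with
  | Bot => False
  | Eq t u => teval M e t = teval M e u
  | Lt t u => lt M (teval M e t) (teval M e u)
  | Mem t X => el M (teval M e t) (v X)
  | Imp p q => eval M e v p -> eval M e v q
  | AllN p => forall x, eval M (scons x e) v p
  | AllS p => forall X, eval M e (scons X v) p
  end.

Definition models (M : structure) (T : formula -> Prop) : Prop :=
  forall p e v, T p -> eval M e v p.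

Section Henkin.

Variables (T : formula -> Prop) (HT : subst_closed T).

Definition consistent (G : list formula) : Prop := ~ derives T G Bot.

Lemma neg_of_inconsistent G p : ~ consistent (p :: G) -> derives T G (Neg p).
Proof. intros H; apply ImpI; now apply NNPP. Qed.

(** The language has no constants to spare, so variables serve as Henkin
    witnesses; a fresh one exists because every stage is a finite list. *)
Definition extends (p : formula) (G G' : list formula) : Prop :=
  incl G G' /\
  (In p G' \/
   In (Neg p) G' /\
   (forall q, p = AllN q -> exists t, In (Neg (substN t q)) G') /\
   (forall q, p = AllS q -> exists Y, In (Neg (substS Y q)) G')).

(** If [Neg q] could not be added, [G] would derive [q] and hence [p], against [Neg p]. With [q] an
    instance of a refuted universal formula [p], this admits the Henkin witness. *)
Lemma consistent_cons G p q :
  consistent G -> derives T G (Neg p) ->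
  (derives T G q -> derives T G p) -> consistent (Neg q :: G).
Proof.
  intros HG Hp Hq H; apply HG.
  apply ImpE with p; [exact Hp|]; apply Hq; now apply RAA.
Qed.

Lemma consistent_extends p G :
  consistent G -> exists G', consistent G' /\ extends p G G'.
Proof.
  intros HG; destruct (classic (consistent (p :: G))) as [H|H].
  { exists (p :: G); split; [exact H|]; split; [|left; left; reflexivity].
    apply incl_tl, incl_refl. }
  apply neg_of_inconsistent in H.
  assert (HG' : consistent (Neg p :: G)) by (eapply consistent_cons; eauto).
  assert (Hp : derives T (Neg p :: G) (Neg p)) by (apply Hyp; left; reflexivity).
  destruct p as [| | | | |q|q];
    try (eexists (Neg _ :: G); split; [exact HG'|]; split;
         [apply incl_tl, incl_refl|]; right; split; [left; reflexivity|];
         split; intros; discriminate).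
  - destruct (generalizeN T (Neg (AllN q) :: G) q HT) as [x Hx].
    exists (Neg (substN (Var x) q) :: Neg (AllN q) :: G); split.
    { exact (consistent_cons _ _ _ HG' Hp Hx). }
    split; [do 2 apply incl_tl; apply incl_refl|right].
    split; [right; left; reflexivity|split; [intros q' Hq'; injection Hq' as <-|discriminate]].
    exists (Var x); left; reflexivity.
  - destruct (generalizeS T (Neg (AllS q) :: G) q HT) as [Y HY].
    exists (Neg (substS Y q) :: Neg (AllS q) :: G); split.
    { exact (consistent_cons _ _ _ HG' Hp HY). }
    split; [do 2 apply incl_tl; apply incl_refl|right].
    split; [right; left; reflexivity|split; [discriminate|intros q' Hq'; injection Hq' as <-]].
    exists Y; left; reflexivity.
Qed.

(** Decoding is by choice: the [n]-th formula is one with code [n] if there is one, and arbitrary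
    otherwise. *)
Lemma formula_enumeration : exists en : nat -> formula, forall p, exists n, en n = p.
Proof.
  exists (fun n => epsilon (inhabits Bot) (fun p => fcode p = n)); intros p.
  exists (fcode p); apply fcode_inj.
  apply (epsilon_spec (inhabits Bot) (fun q => fcode q = fcode p)); eauto.
Qed.

Record complete (W : formula -> Prop) : Prop := {
  complete_derives G p : (forall q, In q G -> W q) -> derives T G p -> W p;
  complete_Bot : ~ W Bot;
  complete_neg p : ~ W p -> W (Neg p);
  complete_AllN q : ~ W (AllN q) -> exists t, W (Neg (substN t q));
  complete_AllS q : ~ W (AllS q) -> exists Y, W (Neg (substS Y q)) }.

Lemma Lindenbaum G : consistent G ->
  exists W, complete W /\ forall p, In p G -> W p.
Proof.
  intros HG; destruct formula_enumeration as [en Hen].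
  pose (next := fun n (H : {G | consistent G}) =>
    constructive_indefinite_description _
      (consistent_extends (en n) (proj1_sig H) (proj2_sig H))).
  (* Each stage carries the proof of its consistency, from which the next extension is chosen. *)
  pose (stage := fix stage n : {G | consistent G} := match n with
    | 0 => exist _ G HG
    | S n => exist _ (proj1_sig (next n (stage n)))
                     (proj1 (proj2_sig (next n (stage n)))) end).
  assert (Hstep : forall n,
    extends (en n) (proj1_sig (stage n)) (proj1_sig (stage (S n)))).
  { intros n; exact (proj2 (proj2_sig (next n (stage n)))). }
  assert (Hmono : forall m n, m <= n ->
    incl (proj1_sig (stage m)) (proj1_sig (stage n))).
  { intros m n H; induction H; [apply incl_refl|].
    eapply incl_tran; [exact IHle|]; apply Hstep. }
  set (W := fun p => exists n, In p (proj1_sig (stage n))).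
  (* A finite part of the union lies in a single stage already, so the consistency of the stages
     passes to [W]. *)
  assert (Hcover : forall L, (forall q, In q L -> W q) ->
    exists n, incl L (proj1_sig (stage n))).
  { induction L as [|p L IH]; intros HL.
    - exists 0; intros ? [].
    - destruct IH as [n Hn]; [intros; apply HL; now right|].
      destruct (HL p) as [m Hm]; [now left|].
      exists (n + m); intros q [<-|Hq].
      + apply (Hmono m); [lia|exact Hm].
      + apply (Hmono n); [lia|auto]. }
  assert (Hdec : forall p, W p \/ W (Neg p) /\
    (forall q, p = AllN q -> exists t, W (Neg (substN t q))) /\
    (forall q, p = AllS q -> exists Y, W (Neg (substS Y q)))).
  { intros p; destruct (Hen p) as [n <-].
    destruct (Hstep n) as [_ [H|[H1 [H2 H3]]]].
    - left; exists (S n); exact H.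
    - right; split; [exists (S n); exact H1|]; split; intros q Hq.
      + destruct (H2 q Hq) as [t Ht]; exists t, (S n); exact Ht.
      + destruct (H3 q Hq) as [Y HY]; exists Y, (S n); exact HY. }
  assert (Hcons : forall L, (forall q, In q L -> W q) -> consistent L).
  { intros L HL Hbot; destruct (Hcover L HL) as [n Hn].
    apply (proj2_sig (stage n)); eapply derives_weaken; eauto. }
  exists W; split; [constructor|].
  - intros L p HL Hp; destruct (Hdec p) as [H|[H _]]; [exact H|exfalso].
    apply (Hcons (Neg p :: L)).
    + intros q [<-|Hq]; auto.
    + apply ImpE with p; [apply Hyp; now left|].
      eapply derives_weaken; [exact Hp|apply incl_tl, incl_refl].
  - intros H; apply (Hcons (Bot :: nil)); [intros q [<-|[]]; exact H|].
    apply Hyp; now left.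
  - intros p Hp; destruct (Hdec p) as [H|[H _]]; tauto.
  - intros q Hp; destruct (Hdec (AllN q)) as [H|[_ [H _]]]; [tauto|auto].
  - intros q Hp; destruct (Hdec (AllS q)) as [H|[_ [_ H]]]; [tauto|auto].
  - intros p Hp; exists 0; exact Hp.
Qed.

(** * The term model of a complete theory *)

Section TermModel.

Variables (W : formula -> Prop) (HW : complete W).

Lemma W_mp p q : W (Imp p q) -> W p -> W q.
Proof.
  intros H1 H2; apply (complete_derives W HW (Imp p q :: p :: nil)).
  - intros r [<-|[<-|[]]]; assumption.
  - apply ImpE with p; apply Hyp; simpl; auto.
Qed.

Lemma W_Imp p q : W (Imp p q) <-> (W p -> W q).
Proof.
  split; [apply W_mp|]; intros H.
  destruct (classic (W p)) as [Hp|Hp].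
  - apply (complete_derives W HW (q :: nil)).
    + intros r [<-|[]]; auto.
    + apply ImpI, Hyp; simpl; auto.
  - apply (complete_derives W HW (Neg p :: nil)).
    + intros r [<-|[]]; now apply complete_neg.
    + apply ImpI, RAA, ImpE with p; apply Hyp; simpl; auto.
Qed.

Lemma W_AllN q : W (AllN q) <-> forall t, W (substN t q).
Proof.
  split.
  - intros H t; apply (complete_derives W HW (AllN q :: nil)).
    + intros r [<-|[]]; exact H.
    + apply AllNE, Hyp; now left.
  - intros H; apply NNPP; intros Hq.
    destruct (complete_AllN W HW q Hq) as [t Ht].
    apply (complete_Bot W HW); exact (W_mp _ _ Ht (H t)).
Qed.

Lemma W_AllS q : W (AllS q) <-> forall Y, W (substS Y q).
Proof.
  split.
  - intros H Y; apply (complete_derives W HW (AllS q :: nil)).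
    + intros r [<-|[]]; exact H.
    + apply AllSE, Hyp; now left.
  - intros H; apply NNPP; intros Hq.
    destruct (complete_AllS W HW q Hq) as [Y HY].
    apply (complete_Bot W HW); exact (W_mp _ _ HY (H Y)).
Qed.

Lemma W_rewrite p t u : W (Eq t u) -> W (substN t p) -> W (substN u p).
Proof.
  intros H1 H2; apply (complete_derives W HW (Eq t u :: substN t p :: nil)).
  - intros r [<-|[<-|[]]]; assumption.
  - apply EqSubst with t; apply Hyp; simpl; auto.
Qed.

Lemma W_refl t : W (Eq t t).
Proof. apply (complete_derives W HW nil); [intros ? []|apply EqRefl]. Qed.

Lemma tsubst_tlift t u : tsubst (scons u Var) (tlift t) = t.
Proof. unfold tlift; rewrite tsubst_tsubst; apply tsubst_Var. Qed.

Lemma W_sym t u : W (Eq t u) -> W (Eq u t).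
Proof.
  intros H; generalize (W_rewrite (Eq (Var 0) (tlift t)) t u H).
  unfold substN; simpl; rewrite !tsubst_tlift; intros H'; apply H', W_refl.
Qed.

Lemma W_trans t u w : W (Eq t u) -> W (Eq u w) -> W (Eq t w).
Proof.
  intros H1 H2; generalize (W_rewrite (Eq (tlift t) (Var 0)) u w H2).
  unfold substN; simpl; rewrite !tsubst_tlift; auto.
Qed.

(** [eval] interprets [Eq] as equality of elements, so terms are divided by the equality of [W].
    Classes are predicates, which extensionality makes equal when the terms are equal in [W]. *)
Definition class (t : term) : term -> Prop := fun u => W (Eq t u).

Lemma class_eq t u : class t = class u <-> W (Eq t u).
Proof.
  split.
  - intros H; change (class t u); rewrite H; apply W_refl.
  - intros H; apply functional_extensionality; intro w.
    apply propositional_extensionality; split; intros H'.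
    + apply W_trans with t; [now apply W_sym|exact H'].
    + now apply W_trans with u.
Qed.

Definition carrier : Type := {P : term -> Prop | exists t, P = class t}.

Definition inj (t : term) : carrier := exist _ (class t) (ex_intro _ t eq_refl).

Lemma inj_eq t u : inj t = inj u <-> W (Eq t u).
Proof.
  rewrite <- class_eq; split; intros H.
  - exact (f_equal (@proj1_sig _ _) H).
  - now apply subset_eq_compat.
Qed.

Definition rep (x : carrier) : term :=
  proj1_sig (constructive_indefinite_description _ (proj2_sig x)).

Lemma inj_rep x : inj (rep x) = x.
Proof.
  unfold rep; destruct constructive_indefinite_description as [t Ht]; simpl.
  destruct x as [P HP]; simpl in *; now apply subset_eq_compat.
Qed.

Lemma rep_inj t : W (Eq (rep (inj t)) t).
Proof. apply inj_eq, inj_rep. Qed.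

(** One argument is replaced at a time by [W_rewrite], with variable 0 marking its place and the
    other terms lifted out of the way. *)
Lemma W_cong2 (F : term -> term -> term) :
  (forall s t u, tsubst s (F t u) = F (tsubst s t) (tsubst s u)) ->
  forall t t' u u', W (Eq t t') -> W (Eq u u') -> W (Eq (F t u) (F t' u')).
Proof.
  intros HF t t' u u' Ht Hu.
  apply W_trans with (F t' u).
  - generalize (W_rewrite (Eq (tlift (F t u)) (F (Var 0) (tlift u))) t t' Ht).
    unfold substN; simpl; rewrite !tsubst_tlift, !HF, !tsubst_tlift; simpl.
    intros H; apply H, W_refl.
  - generalize (W_rewrite (Eq (tlift (F t' u)) (F (tlift t') (Var 0))) u u' Hu).
    unfold substN; simpl; rewrite !tsubst_tlift, !HF, !tsubst_tlift; simpl.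
    intros H; apply H, W_refl.
Qed.

(** Equality of sets is not primitive, so the set variables themselves can be the sets, without a
    quotient. *)
Definition term_model : structure := {|
  dom := carrier;
  sets := nat;
  zero := inj Zero;
  one := inj One;
  add := fun x y => inj (Add (rep x) (rep y));
  mul := fun x y => inj (Mul (rep x) (rep y));
  exp := fun x y => inj (Exp (rep x) (rep y));
  lt := fun x y => W (Lt (rep x) (rep y));
  el := fun x X => W (Mem (rep x) X) |}.

Lemma teval_term_model s t :
  teval term_model (fun n => inj (s n)) t = inj (tsubst s t).
Proof.
  induction t; simpl; try reflexivity; rewrite IHt1, IHt2; apply inj_eq;
    apply W_cong2; auto using rep_inj.
Qed.

Lemma W_Lt t u t' u' : W (Eq t t') -> W (Eq u u') -> W (Lt t u) -> W (Lt t' u').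
Proof.
  intros Ht Hu H.
  generalize (W_rewrite (Lt (Var 0) (tlift u)) t t' Ht).
  generalize (W_rewrite (Lt (tlift t') (Var 0)) u u' Hu).
  unfold substN; simpl; rewrite !tsubst_tlift; auto.
Qed.

Lemma W_Mem t t' X : W (Eq t t') -> W (Mem t X) -> W (Mem t' X).
Proof. intros Ht H; exact (W_rewrite (Mem (Var 0) X) t t' Ht H). Qed.

(** Induction on [p] with the assignment given by substitutions. The quantifier cases hold because
    every element is the class of a term, every set is a variable, and [W] contains a counterexample
    to each universal formula outside it. *)
Lemma truth p s r :
  eval term_model (fun n => inj (s n)) r p <-> W (fsubst s r p).
Proof.
  revert s r; induction p; intros s r; cbn [eval fsubst].
  - split; [tauto|apply (complete_Bot W HW)].
  - rewrite !teval_term_model; apply inj_eq.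
  - rewrite !teval_term_model; split; apply W_Lt;
      auto using rep_inj, W_sym.
  - rewrite !teval_term_model; split; apply W_Mem;
      auto using rep_inj, W_sym.
  - rewrite IHp1, IHp2, W_Imp; reflexivity.
  - rewrite W_AllN; split; intros H.
    + intros t; rewrite fsubst_up; apply IHp.
      rewrite (scons_ext (inj t) _ (fun n => inj (s n))); [apply H|reflexivity..].
    + intros x; rewrite <- (inj_rep x).
      rewrite <- (scons_ext (inj (rep x)) (fun n => inj (scons (rep x) s n)))
        by reflexivity.
      apply IHp; rewrite <- fsubst_up; apply H.
  - rewrite W_AllS; split; intros H Y.
    + rewrite fsubst_upS; apply IHp, H.
    + apply IHp; rewrite <- fsubst_upS; apply H.
Qed.

Lemma term_model_models : models term_model T.
Proof.
  intros p e v Hp.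
  replace e with (fun n => inj (rep (e n)))
    by (apply functional_extensionality; intro; apply inj_rep).
  apply truth, (complete_derives W HW nil); [intros ? []|].
  apply Ax, HT, Hp.
Qed.

End TermModel.

(** If [p] is not derivable, [Neg p] is consistent by [RAA], and the term model of a complete
    extension satisfies [T] but refutes [p]. *)
Lemma completeness p :
  (forall M, models M T -> forall e v, eval M e v p) -> T ⊢ p.
Proof.
  intros H; apply NNPP; intros Hp.
  destruct (Lindenbaum (Neg p :: nil)) as [W [HW HWp]].
  { intros H'; apply Hp; now apply RAA. }
  apply (complete_Bot W HW).
  apply (W_mp W HW p); [apply HWp; now left|].
  rewrite <- (fsubst_Var p); apply (truth W HW p Var).
  apply H; now apply term_model_models.
Qed.

End Henkin.
(** * RCA_0^* and its models *)

Lemma tsubst_up_tlift s t : tsubst (up s) (tlift t) = tlift (tsubst s t).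
Proof. unfold tlift; now rewrite !tsubst_tsubst. Qed.

Lemma Sigma00_subst p s r : Sigma00 p -> Sigma00 (fsubst s r p).
Proof.
  intros H; revert s r; induction H; intros s r; cbn [fsubst]; try now constructor.
  - cbn [tsubst]; rewrite tsubst_up_tlift; apply Sigma00_All; auto.
  - unfold ExN, And, Neg; cbn [fsubst tsubst]; rewrite tsubst_up_tlift.
    apply (Sigma00_Ex (tsubst s t) (fsubst (up s) r p)); auto.
Qed.

Lemma induction_subst p s r :
  fsubst s r (induction p) = induction (fsubst (up s) r p).
Proof.
  unfold induction, And, Neg; cbn [fsubst].
  rewrite fsubst_substN, !fsubst_fsubst; do 7 f_equal.
  apply functional_extensionality; intros [|n]; simpl; [reflexivity|].
  unfold tlift; now rewrite !tsubst_tsubst.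
Qed.

Lemma comprehension_subst p q s r :
  fsubst s r (comprehension p q) =
  comprehension (fsubst (up s) r p) (fsubst (up s) r q).
Proof.
  unfold comprehension, ExS, Iff, And, Neg; cbn [fsubst].
  now rewrite !fsubst_liftS.
Qed.

(** Basic and exponentiation axioms are closed. In the two schemes a substitution acts on the
    parameters and keeps the complexity of the formulas. *)
Lemma RCA0star_subst_closed : subst_closed RCA0star.
Proof.
  intros p s r [q []|q []|q Hq|q q' [q1 [H1 ->]] [q2 [H2 ->]]];
    try (apply RCA0star_basic; constructor);
    try (apply RCA0star_exp; constructor).
  - rewrite induction_subst; apply RCA0star_induction; now apply Sigma00_subst.
  - rewrite comprehension_subst; apply RCA0star_comprehension.
    + exists (fsubst (up (up s)) r q1); split; [now apply Sigma00_subst|reflexivity].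
    + exists (fsubst (up (up s)) r q2); split; [now apply Sigma00_subst|reflexivity].
Qed.

(** * Truth under substitution and for the defined connectives *)

Section Eval.

Variable M : structure.

Lemma teval_tsubst e s t :
  teval M e (tsubst s t) = teval M (fun n => teval M e (s n)) t.
Proof. induction t; simpl; congruence. Qed.

Lemma eval_fsubst e v s r p :
  eval M e v (fsubst s r p) <->
  eval M (fun n => teval M e (s n)) (fun X => v (r X)) p.
Proof.
  revert e v s r; induction p; intros e v s r; cbn [eval fsubst];
    rewrite ?teval_tsubst; try reflexivity.
  - now rewrite IHp1, IHp2.
  - assert (H : forall x, (fun n => teval M (scons x e) (up s n)) =
        scons x (fun n => teval M e (s n))).
    { intro x; apply scons_ext; [reflexivity|]; intro n; simpl.
      unfold tlift; now rewrite teval_tsubst. }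
    split; intros Hp x; specialize (Hp x); rewrite ?IHp, ?H in *; exact Hp.
  - assert (H : forall X, (fun n => scons X v (upS r n)) =
        scons X (fun n => v (r n))) by (intro; now apply scons_ext).
    split; intros Hp x; specialize (Hp x); rewrite ?IHp, ?H in *; exact Hp.
Qed.

(** The clauses for the connectives are stated up to equivalence of the parts, so that [sem] can
    match a formula with a given proposition connective by connective. Those for defined connectives
    rest on classical logic. *)
Lemma eval_Neg e v p P :
  (eval M e v p <-> P) -> (eval M e v (Neg p) <-> ~ P).
Proof. simpl; tauto. Qed.

Lemma eval_Top e v : eval M e v Top <-> True.
Proof. simpl; tauto. Qed.

Lemma eval_Imp e v p q (P Q : Prop) :
  (eval M e v p <-> P) -> (eval M e v q <-> Q) ->
  (eval M e v (Imp p q) <-> (P -> Q)).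
Proof. simpl; tauto. Qed.

Lemma eval_And e v p q P Q :
  (eval M e v p <-> P) -> (eval M e v q <-> Q) ->
  (eval M e v (And p q) <-> P /\ Q).
Proof. simpl; tauto. Qed.

Lemma eval_Or e v p q P Q :
  (eval M e v p <-> P) -> (eval M e v q <-> Q) ->
  (eval M e v (Or p q) <-> P \/ Q).
Proof. simpl; tauto. Qed.

Lemma eval_Iff e v p q P Q :
  (eval M e v p <-> P) -> (eval M e v q <-> Q) ->
  (eval M e v (Iff p q) <-> (P <-> Q)).
Proof. simpl; tauto. Qed.

Lemma eval_AllN e v p P :
  (forall x, eval M (scons x e) v p <-> P x) ->
  (eval M e v (AllN p) <-> forall x, P x).
Proof. simpl; firstorder. Qed.

Lemma eval_AllS e v p P :
  (forall X, eval M e (scons X v) p <-> P X) ->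
  (eval M e v (AllS p) <-> forall X, P X).
Proof. simpl; firstorder. Qed.

Lemma eval_ExN e v p P :
  (forall x, eval M (scons x e) v p <-> P x) ->
  (eval M e v (ExN p) <-> exists x, P x).
Proof.
  intros H; simpl; split.
  - intros H1; apply NNPP; intros H2; apply H1; intros x Hx; apply H2.
    exists x; now apply H.
  - intros [x Hx] H1; apply (H1 x); now apply H.
Qed.

Lemma eval_ExS e v p P :
  (forall X, eval M e (scons X v) p <-> P X) ->
  (eval M e v (ExS p) <-> exists X, P X).
Proof.
  intros H; simpl; split.
  - intros H1; apply NNPP; intros H2; apply H1; intros x Hx; apply H2.
    exists x; now apply H.
  - intros [x Hx] H1; apply (H1 x); now apply H.
Qed.

End Eval.

Ltac sem :=
  repeat first
  [ apply eval_Iff | apply eval_Or | apply eval_And | apply eval_Top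
  | apply eval_ExN; intro | apply eval_ExS; intro
  | apply eval_AllN; intro | apply eval_AllS; intro
  | apply eval_Neg | apply eval_Imp | reflexivity ].
Section Model.

Variables (M : structure) (HM : models M RCA0star) (v0 : nat -> sets M).

Notation D := (dom M).
Notation "0" := (zero M).
Notation "1" := (one M).
Infix "+" := (add M).
Infix "*" := (mul M).
Infix "^" := (exp M).
Infix "<" := (lt M).
Notation "x <= y" := (x < y \/ x = y).
Infix "∈" := (el M) (at level 70, no associativity).

(** [Def] carries an arbitrary index type [X] so that a bounded quantifier can
    be absorbed by passing from [X] to [X * D]. *)
Definition TDef {X} (e : X -> nat -> D) (A : X -> D) : Prop :=
  exists t, forall x, teval M (e x) t = A x.

Definition Def {X} (e : X -> nat -> D) (v : nat -> sets M) (P : X -> Prop) : Prop :=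
  exists p, Sigma00 p /\ forall x, eval M (e x) v p <-> P x.

Notation bind e := (fun xy => scons (snd xy) (e (fst xy))).

Definition pairing (x y : D) : D := (x + y) * (x + y) + x.

(** [d] is the digit of [p] in base [b] at position [j], counted from the least significant one. The
    quotient [q] and the remainder [r] are bounded to keep the condition Sigma-0-0. *)
Definition digit (b p j d : D) : Prop :=
  exists q, q < p + 1 /\ exists r, r < b ^ j /\ d < b /\ p = (q * b + d) * b ^ j + r.

(** * Closure properties of Sigma-0-0 definability *)

Section Def.

Context {X : Type} (e : X -> nat -> D) (v : nat -> sets M).

Lemma TDef_zero : TDef e (fun _ => 0).
Proof. exists Zero; reflexivity. Qed.

Lemma TDef_one : TDef e (fun _ => 1).
Proof. exists One; reflexivity. Qed.

Lemma TDef_add A B : TDef e A -> TDef e B -> TDef e (fun x => A x + B x).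
Proof. intros [t Ht] [u Hu]; exists (Add t u); intro; simpl; congruence. Qed.

Lemma TDef_mul A B : TDef e A -> TDef e B -> TDef e (fun x => A x * B x).
Proof. intros [t Ht] [u Hu]; exists (Mul t u); intro; simpl; congruence. Qed.

Lemma TDef_exp A B : TDef e A -> TDef e B -> TDef e (fun x => A x ^ B x).
Proof. intros [t Ht] [u Hu]; exists (Exp t u); intro; simpl; congruence. Qed.

Lemma TDef_pairing A B :
  TDef e A -> TDef e B -> TDef e (fun x => pairing (A x) (B x)).
Proof. intros HA HB; apply TDef_add, HA; apply TDef_mul; now apply TDef_add. Qed.

Lemma Def_eq A B : TDef e A -> TDef e B -> Def e v (fun x => A x = B x).
Proof.
  intros [t Ht] [u Hu]; exists (Eq t u); split; [constructor|].
  intro x; simpl; now rewrite Ht, Hu.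
Qed.

Lemma Def_lt A B : TDef e A -> TDef e B -> Def e v (fun x => A x < B x).
Proof.
  intros [t Ht] [u Hu]; exists (Lt t u); split; [constructor|].
  intro x; simpl; now rewrite Ht, Hu.
Qed.

Lemma Def_el n Z A : v n = Z -> TDef e A -> Def e v (fun x => A x ∈ Z).
Proof.
  intros <- [t Ht]; exists (Mem t n); split; [constructor|].
  intro x; simpl; now rewrite Ht.
Qed.

Lemma Def_imp P Q : Def e v P -> Def e v Q -> Def e v (fun x => P x -> Q x).
Proof.
  intros [p [Hp HP]] [q [Hq HQ]]; exists (Imp p q); split; [now constructor|].
  intro x; apply eval_Imp; auto.
Qed.

Lemma Def_false : Def e v (fun _ => False).
Proof. exists Bot; split; [constructor|reflexivity]. Qed.

Lemma Def_not P : Def e v P -> Def e v (fun x => ~ P x).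
Proof. intros H; apply Def_imp; [exact H|apply Def_false]. Qed.

Lemma Def_iff_compat P Q : (forall x, P x <-> Q x) -> Def e v P -> Def e v Q.
Proof.
  intros H [p [Hp HP]]; exists p; split; [exact Hp|].
  intro x; now rewrite HP.
Qed.

Lemma Def_and P Q : Def e v P -> Def e v Q -> Def e v (fun x => P x /\ Q x).
Proof.
  intros HP HQ; apply Def_iff_compat with (fun x => ~ (P x -> ~ Q x)).
  - intro x; tauto.
  - apply Def_not, Def_imp, Def_not; assumption.
Qed.

Lemma Def_or P Q : Def e v P -> Def e v Q -> Def e v (fun x => P x \/ Q x).
Proof.
  intros HP HQ; apply Def_iff_compat with (fun x => ~ P x -> Q x).
  - intro x; tauto.
  - apply Def_imp; [apply Def_not|]; assumption.
Qed.

Lemma Def_all A (P : X -> D -> Prop) :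
  TDef e A -> Def (bind e) v (fun xy => P (fst xy) (snd xy)) ->
  Def e v (fun x => forall y, y < A x -> P x y).
Proof.
  intros [t Ht] [p [Hp HP]].
  exists (AllN (Imp (Lt (Var 0) (tlift t)) p)); split; [now constructor|].
  intro x; apply eval_AllN; intro y; apply eval_Imp; [|apply (HP (x, y))].
  simpl; unfold tlift; rewrite teval_tsubst; simpl; now rewrite Ht.
Qed.

Lemma Def_ex A (P : X -> D -> Prop) :
  TDef e A -> Def (bind e) v (fun xy => P (fst xy) (snd xy)) ->
  Def e v (fun x => exists y, y < A x /\ P x y).
Proof.
  intros [t Ht] [p [Hp HP]].
  exists (ExN (And (Lt (Var 0) (tlift t)) p)); split; [now constructor|].
  intro x; apply eval_ExN; intro y; apply eval_And; [|apply (HP (x, y))].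
  simpl; unfold tlift; rewrite teval_tsubst; simpl; now rewrite Ht.
Qed.

End Def.

(** Indices past the end of the list get default values. For sets these come from the assignment
    [v0], as a [structure] has no distinguished set. *)
Definition params (l : list D) (n : nat) : D := nth n l 0.
Definition sparams (l : list (sets M)) (n : nat) : sets M := nth n l (v0 n).
Notation ctx1 l := (fun x => scons x (params l)).
Notation ctx2 l := (fun xy => scons (snd xy) (scons (fst xy) (params l))).

(** * Induction and comprehension for definable predicates *)

Lemma Delta00_induction lp ls (P : D -> Prop) :
  Def (ctx1 lp) (sparams ls) P ->
  P 0 -> (forall x, P x -> P (x + 1)) -> forall x, P x.
Proof.
  intros [p [Hp HP]] H0 HS.
  assert (H := HM _ (params lp) (sparams ls) (RCA0star_induction p Hp)).
  unfold induction in H.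
  cbn [eval] in H; intro x; apply HP; revert x; apply H.
  apply (eval_And _ _ _ _ _ _ _ (iff_refl _) (iff_refl _)); split.
  - unfold substN; rewrite eval_fsubst.
    rewrite (scons_ext 0 _ (params lp)) by reflexivity; now apply HP.
  - intros x Hx; rewrite eval_fsubst.
    rewrite (scons_ext (x + 1) _ (params lp)) by reflexivity.
    apply HP, HS, HP, Hx.
Qed.

(** [P] and [Q] are the matrices of the Sigma and of the Pi form. In [ctx2] variable 0 is the
    witness, variable 1 the candidate element, and the parameters follow. *)
Lemma Delta01_comprehension lp ls (P Q : D -> D -> Prop) :
  Def (ctx2 lp) (sparams ls) (fun xw => P (fst xw) (snd xw)) ->
  Def (ctx2 lp) (sparams ls) (fun xw => Q (fst xw) (snd xw)) ->
  (forall x, (exists w, P x w) <-> (forall w, Q x w)) ->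
  exists Z, forall x, x ∈ Z <-> exists w, P x w.
Proof.
  intros [p [Hp HP]] [q [Hq HQ]] H.
  assert (HC := HM _ (params lp) (sparams ls) (RCA0star_comprehension (ExN p) (AllN q)
    (ex_intro _ p (conj Hp eq_refl)) (ex_intro _ q (conj Hq eq_refl)))).
  assert (HP' : forall v x, eval M (scons x (params lp)) v (ExN p) <->
    exists w, eval M (scons w (scons x (params lp))) v p).
  { intros v x; apply eval_ExN; reflexivity. }
  unfold comprehension in HC; cbn [eval] in HC.
  eapply (proj1 (eval_ExS _ _ _ _ _ (fun Z => eval_AllN _ _ _ _ _ (fun x =>
    eval_Iff _ _ _ _ _ _ _ (iff_refl _) (iff_refl _))))) in HC.
  - destruct HC as [Z HZ]; exists Z; intro x; rewrite (HZ x).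
    unfold liftS; rewrite eval_fsubst; cbn [teval]; rewrite HP'.
    split; intros [w Hw]; exists w; apply (HP (x, w)), Hw.
  - intro x; apply (eval_Iff _ _ _ _ _ _ _ (iff_refl _) (iff_refl _)).
    rewrite HP'; split.
    + intros [w Hw] w'; apply (HQ (x, w')); apply H.
      exists w; apply (HP (x, w)), Hw.
    + intros Hx; destruct (proj2 (H x)) as [w Hw].
      { intro w; apply (HQ (x, w)), (Hx w). }
      exists w; apply (HP (x, w)), Hw.
Qed.

(** A vacuous unbounded quantifier presents [P] both in Sigma-0-1 and in Pi-0-1 form. *)
Lemma Delta00_comprehension lp ls (P : D -> Prop) :
  Def (ctx2 lp) (sparams ls) (fun xw => P (fst xw)) ->
  exists Z, forall x, x ∈ Z <-> P x.
Proof.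
  intros HP.
  destruct (Delta01_comprehension lp ls (fun x _ => P x) (fun x _ => P x) HP HP)
    as [Z HZ].
  - intro x; split; [intros [_ H] _; exact H|intros H; exists 0; exact (H 0)].
  - exists Z; intro x; rewrite HZ; split; [intros [_ H]; exact H|exists 0; exact H].
Qed.

(** The following tactics rebuild the formula behind a predicate from its shape. At a leaf they try
    the variable indices in turn until one evaluates to the given parameter. *)
Ltac tdef_leaf n :=
  lazymatch n with
  | 20 => fail
  | _ => first [exists (Var n); intro; reflexivity | tdef_leaf constr:(S n)]
  end.
Ltac tdef :=
  first [ apply TDef_zero | apply TDef_one
        | apply TDef_add; [tdef|tdef] | apply TDef_mul; [tdef|tdef]
        | apply TDef_exp; [tdef|tdef] | apply TDef_pairing; [tdef|tdef]
        | tdef_leaf O ].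
Ltac def_el n :=
  lazymatch n with
  | 10 => fail
  | _ => first [apply (Def_el _ _ n); [reflexivity|tdef] | def_el constr:(S n)]
  end.
Ltac def :=
  lazymatch goal with
  | |- Def ?e ?v ?P => change (Def e v (fun x => P x)); cbv beta
  end;
  lazymatch goal with
  | |- Def _ _ (fun x => digit _ _ _ _) => unfold digit; def
  | |- Def _ _ (fun x => False) => apply Def_false
  | |- Def _ _ (fun x => _ = _) => apply Def_eq; tdef
  | |- Def _ _ (fun x => _ < _) => apply Def_lt; tdef
  | |- Def _ _ (fun x => _ ∈ _) => def_el O
  | |- Def _ _ (fun x => ~ _) => apply Def_not; def
  | |- Def _ _ (fun x => _ /\ _) => apply Def_and; def
  | |- Def _ _ (fun x => _ \/ _) => apply Def_or; def
  | |- Def _ _ (fun x => forall y, y < _ -> _) => apply Def_all; [tdef|def]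
  | |- Def _ _ (fun x => exists y, y < _ /\ _) => apply Def_ex; [tdef|def]
  | |- Def _ _ (fun x => _ -> _) => apply Def_imp; def
  end.

(** * Arithmetic in a model *)

Lemma add_0_r x : x + 0 = x.
Proof. exact (HM _ (params nil) v0 (RCA0star_basic _ add_0) x). Qed.

Lemma add_1_r x y : x + (y + 1) = x + y + 1.
Proof. exact (HM _ (params nil) v0 (RCA0star_basic _ add_succ) x y). Qed.

Lemma mul_0_r x : x * 0 = 0.
Proof. exact (HM _ (params nil) v0 (RCA0star_basic _ mul_0) x). Qed.

Lemma mul_1_add_r x y : x * (y + 1) = x * y + x.
Proof. exact (HM _ (params nil) v0 (RCA0star_basic _ mul_succ) x y). Qed.

Lemma pow_0 x : x ^ 0 = 1.
Proof. exact (HM _ (params nil) v0 (RCA0star_exp _ exp_0) x). Qed.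

Lemma pow_succ x y : x ^ (y + 1) = x * x ^ y.
Proof. exact (HM _ (params nil) v0 (RCA0star_exp _ exp_succ) x y). Qed.

Lemma add_1_neq_0 x : x + 1 <> 0.
Proof. exact (HM _ (params nil) v0 (RCA0star_basic _ succ_neq0) x). Qed.

Lemma add_1_inj x y : x + 1 = y + 1 -> x = y.
Proof. exact (HM _ (params nil) v0 (RCA0star_basic _ succ_inj) x y). Qed.

Lemma not_lt_0 x : ~ x < 0.
Proof. exact (HM _ (params nil) v0 (RCA0star_basic _ Defs.lt_0) x). Qed.

Lemma lt_add_1 x y : x < y + 1 <-> x <= y.
Proof.
  assert (H := HM _ (params nil) v0 (RCA0star_basic _ lt_succ) x y).
  revert H; apply eval_Iff; sem.
Qed.

Ltac Delta00_ind lp ls :=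
  lazymatch goal with
  | |- forall x, @?P x => apply (Delta00_induction lp ls P); cbv beta; [def| |]
  end.
Ltac ind lp x := revert x; Delta00_ind lp (@nil (sets M)).

Lemma add_0_l x : 0 + x = x.
Proof.
  ind (@nil D) x; [apply add_0_r|]; intros x H.
  now rewrite add_1_r, H.
Qed.

Lemma add_1_l x y : x + 1 + y = x + y + 1.
Proof.
  ind (x :: nil) y; [now rewrite !add_0_r|]; intros y H.
  now rewrite !add_1_r, H.
Qed.

Lemma add_comm x y : x + y = y + x.
Proof.
  ind (x :: nil) y; [now rewrite add_0_r, add_0_l|]; intros y H.
  now rewrite add_1_r, add_1_l, H.
Qed.

Lemma add_assoc x y z : x + (y + z) = x + y + z.
Proof.
  ind (x :: y :: nil) z; [now rewrite !add_0_r|]; intros z H.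
  now rewrite !add_1_r, H.
Qed.

Lemma mul_0_l x : 0 * x = 0.
Proof.
  ind (@nil D) x; [apply mul_0_r|]; intros x H.
  now rewrite mul_1_add_r, H, add_0_r.
Qed.

Lemma mul_1_add_l x y : (x + 1) * y = x * y + y.
Proof.
  ind (x :: nil) y; [now rewrite !mul_0_r, add_0_r|]; intros y H.
  rewrite !mul_1_add_r, H, <- !add_assoc; f_equal.
  rewrite !add_assoc; f_equal; apply add_comm.
Qed.

Lemma mul_comm x y : x * y = y * x.
Proof.
  ind (x :: nil) y; [now rewrite mul_0_r, mul_0_l|]; intros y H.
  now rewrite mul_1_add_r, mul_1_add_l, H.
Qed.

Lemma mul_add_distr x y z : (x + y) * z = x * z + y * z.
Proof.
  ind (x :: y :: nil) z; [now rewrite !mul_0_r, add_0_r|]; intros z H.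
  rewrite !mul_1_add_r, H, <- !add_assoc; f_equal.
  rewrite !add_assoc; f_equal; apply add_comm.
Qed.

Lemma mul_assoc x y z : x * (y * z) = x * y * z.
Proof.
  ind (x :: y :: nil) z; [now rewrite !mul_0_r|]; intros z H.
  now rewrite !mul_1_add_r, mul_comm, mul_add_distr, !(mul_comm _ x), H.
Qed.

Lemma mul_1_l x : 1 * x = x.
Proof. now rewrite <- (add_0_l 1), mul_1_add_l, mul_0_l, add_0_l. Qed.

Lemma D_semiring : semi_ring_theory 0 1 (add M) (mul M) eq.
Proof.
  constructor; auto using add_0_l, add_comm, add_assoc, mul_1_l, mul_0_l,
    mul_comm, mul_assoc, mul_add_distr.
Qed.

Add Ring D_ring : D_semiring.

Lemma add_cancel_r x y z : x + z = y + z -> x = y.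
Proof.
  ind (x :: y :: nil) z; [now rewrite !add_0_r|]; intros z H.
  rewrite !add_1_r; intros H'; now apply H, add_1_inj.
Qed.

Lemma zero_or_succ x : x = 0 \/ exists y, x = y + 1.
Proof.
  (* Induction is available for bounded quantifiers only; a predecessor of [x] lies below [x]. *)
  cut (x = 0 \/ exists y, y < x /\ x = y + 1).
  { intros [H|[y [_ H]]]; eauto. }
  ind (@nil D) x; [now left|].
  intros x _; right; exists x; split; [apply lt_add_1; now right|reflexivity].
Qed.

Lemma lt_add_1_compat x y : x < y -> x + 1 < y + 1.
Proof.
  ind (x :: nil) y; [intros H; now apply not_lt_0 in H|].
  intros y IH [H| ->]%lt_add_1; apply lt_add_1; auto.
Qed.

Lemma lt_0_add_1 x : 0 < x + 1.
Proof.
  ind (@nil D) x; intros; apply lt_add_1; auto.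
Qed.

Lemma lt_iff x y : x < y <-> exists z, y = x + z + 1.
Proof.
  split.
  - cut (x < y -> exists z, z < y /\ y = x + z + 1).
    { intros H H'; destruct (H H') as [z [_ Hz]]; eauto. }
    ind (x :: nil) y; [intros H; now apply not_lt_0 in H|].
    intros y IH [H| ->]%lt_add_1.
    + destruct (IH H) as [z [Hz Hy]]; exists (z + 1); split.
      * now apply lt_add_1_compat.
      * rewrite Hy; ring.
    + exists 0; split; [apply lt_0_add_1|ring].
  - intros [z ->]; ind (x :: nil) z; [apply lt_add_1; right; ring|].
    intros z H; apply lt_add_1; left; now rewrite add_assoc.
Qed.

Lemma le_iff x y : x <= y <-> exists z, y = x + z.
Proof.
  rewrite lt_iff; split.
  - intros [[z ->]| ->]; [exists (z + 1)|exists 0]; ring.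
  - intros [z ->]; destruct (zero_or_succ z) as [->|[w ->]];
      [right; ring|left; exists w; ring].
Qed.

Lemma add_succ_neq x w : x + w + 1 <> x.
Proof.
  intros H; apply (add_1_neq_0 w), (add_cancel_r _ _ x).
  transitivity (x + w + 1); [ring|]; rewrite H; ring.
Qed.

Lemma lt_irrefl x : ~ x < x.
Proof. intros [z H]%lt_iff; exact (add_succ_neq x z (eq_sym H)). Qed.

Lemma lt_trans x y z : x < y -> y < z -> x < z.
Proof.
  rewrite !lt_iff; intros [u ->] [w ->]; exists (u + 1 + w); ring.
Qed.

Lemma le_trans x y z : x <= y -> y <= z -> x <= z.
Proof. intros [H| ->] [H'| ->]; eauto using lt_trans. Qed.

Lemma lt_le_trans x y z : x < y -> y <= z -> x < z.
Proof. intros H [H'| ->]; eauto using lt_trans. Qed.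

Lemma le_lt_trans x y z : x <= y -> y < z -> x < z.
Proof. intros [H| ->] H'; eauto using lt_trans. Qed.

Lemma lt_not_le x y : x < y -> ~ y <= x.
Proof. intros H H'; exact (lt_irrefl x (lt_le_trans _ _ _ H H')). Qed.

Lemma le_antisym x y : x <= y -> y <= x -> x = y.
Proof. intros [H|H] H'; [now apply lt_not_le in H|exact H]. Qed.

Lemma le_0_l x : 0 <= x.
Proof. apply le_iff; exists x; ring. Qed.

Lemma lt_iff_le x y : x < y <-> x + 1 <= y.
Proof.
  rewrite lt_iff, le_iff; split; intros [z ->]; exists z; ring.
Qed.

Lemma lt_succ_diag x : x < x + 1.
Proof. apply lt_add_1; now right. Qed.

Lemma lt_total x y : x < y \/ x = y \/ y < x.
Proof.
  ind (x :: nil) y.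
  - destruct (le_0_l x) as [H|H]; auto.
  - intros y [H|[->|H]].
    + left; apply lt_add_1; auto.
    + left; apply lt_succ_diag.
    + apply lt_iff_le in H; destruct H; auto.
Qed.

Lemma le_or_lt x y : x <= y \/ y < x.
Proof. destruct (lt_total x y) as [H|[H|H]]; auto. Qed.

Lemma not_lt_le x y : ~ x < y -> y <= x.
Proof. destruct (le_or_lt y x); tauto. Qed.

Lemma add_lt_mono_l x y z : z + x < z + y <-> x < y.
Proof.
  rewrite !lt_iff; split; intros [w H]; exists w.
  - apply (add_cancel_r _ _ z); rewrite (add_comm y), H; ring.
  - rewrite H; ring.
Qed.

Lemma add_lt_mono_r x y z : x + z < y + z <-> x < y.
Proof. rewrite !(add_comm _ z); apply add_lt_mono_l. Qed.

Lemma add_le_mono_l x y z : z + x <= z + y <-> x <= y.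
Proof.
  rewrite !le_iff; split; intros [w H]; exists w.
  - apply (add_cancel_r _ _ z); rewrite (add_comm y), H; ring.
  - rewrite H; ring.
Qed.

Lemma le_add_r x y : x <= x + y.
Proof. apply le_iff; now exists y. Qed.

Lemma add_cancel_l x y z : z + x = z + y -> x = y.
Proof. rewrite !(add_comm z); apply add_cancel_r. Qed.

(** * Least and greatest elements *)

Lemma Delta00_least lp ls (P : D -> Prop) x :
  Def (ctx1 lp) (sparams ls) (fun n => forall z, z < n -> ~ P z) ->
  P x -> exists y, P y /\ forall z, z < y -> ~ P z.
Proof.
  intros HP Hx; apply NNPP; intros H.
  assert (HQ : forall n z, z < n -> ~ P z).
  { refine (Delta00_induction lp ls _ HP _ _).
    - intros z Hz; now apply not_lt_0 in Hz.
    - intros n IH z [Hz| ->]%lt_add_1; [auto|].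
      intros Hn; apply H; now exists n. }
  exact (HQ (x + 1) x (lt_succ_diag x) Hx).
Qed.

(** Without a greatest element, induction on [n] would give elements of [P] at or above every [n],
    even at or above [b + 1]. *)
Lemma Delta00_greatest lp ls (P : D -> Prop) b x :
  Def (ctx1 lp) (sparams ls) (fun n => exists y, y < b + 1 /\ P y /\ n <= y) ->
  P x -> (forall y, P y -> y <= b) ->
  exists y, P y /\ forall z, P z -> z <= y.
Proof.
  intros HP Hx Hb; apply NNPP; intros H.
  assert (HQ : forall n, exists y, y < b + 1 /\ P y /\ n <= y).
  { refine (Delta00_induction lp ls _ HP _ _).
    - exists x; repeat split; auto using le_0_l; now apply lt_add_1, Hb.
    - intros n [y [Hy [Py Hn]]].
      apply NNPP; intros H'; apply H; exists y; split; [exact Py|].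
      intros z Hz; apply not_lt_le; intros Hyz; apply H'; exists z.
      repeat split; [now apply lt_add_1, Hb|exact Hz|].
      apply lt_iff_le; now apply le_lt_trans with y. }
  destruct (HQ (b + 1)) as [y [Hy [_ Hy']]]; exact (lt_not_le _ _ Hy Hy').
Qed.

(** [G j i] is to be read as: the value at [j] is at most the value at [i]. The induction over
    initial segments looks for an index of a largest value and does not mention the values, which
    therefore need no bound in advance. *)
Lemma Delta00_argmax lp ls (G : D -> D -> Prop) N :
  Def (ctx1 lp) (sparams ls) (fun n => n < N + 1 -> n = 0 \/
    exists i, i < n /\ forall j, j < n -> G j i) ->
  (forall i j, i < N -> j < N -> G i j \/ G j i) ->
  (forall i j k, i < N -> j < N -> k < N -> G i j -> G j k -> G i k) ->
  N = 0 \/ exists i, i < N /\ forall j, j < N -> G j i.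
Proof.
  intros HD Htot Htr.
  cut (forall n, n < N + 1 -> n = 0 \/ exists i, i < n /\ forall j, j < n -> G j i).
  { intros H; apply H, lt_succ_diag. }
  refine (Delta00_induction lp ls _ HD _ _); [now left|].
  intros n IH Hn; right.
  assert (HnN : n < N).
  { apply lt_iff_le; now apply lt_add_1. }
  assert (HN : forall i, i <= n -> i < N) by (intros; now apply le_lt_trans with n).
  destruct IH as [->|[i [Hi Hmax]]]; [apply lt_add_1; now left| |].
  - exists 0; split; [apply lt_succ_diag|].
    intros j [Hj| ->]%lt_add_1; [now apply not_lt_0 in Hj|].
    destruct (Htot 0 0); auto.
  - destruct (Htot i n) as [H|H]; auto.
    + exists n; split; [apply lt_succ_diag|].
      intros j [Hj| ->]%lt_add_1; [|destruct (Htot n n); auto].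
      apply Htr with i; auto.
    + exists i; split; [apply lt_add_1; now left|].
      intros j [Hj| ->]%lt_add_1; auto.
Qed.

(** * Pairing, division and digits *)

Lemma pairing_lt_sum x y x' y' : pairing x y = pairing x' y' -> ~ x + y < x' + y'.
Proof.
  unfold pairing; intros H [z Hz]%lt_iff; rewrite Hz in H.
  (* The square of a sum larger than [x + y] exceeds [(x + y)^2] by more than [x]; the second
     argument, plus one, is the exact difference of the two codes. *)
  apply (add_succ_neq ((x + y) * (x + y) + x)
    (x + (1 + 1) * y + (1 + 1) * (x + y) * z + z * z + (1 + 1) * z + x')).
  symmetry; rewrite H at 1; ring.
Qed.

Lemma pairing_inj x y x' y' : pairing x y = pairing x' y' -> x = x' /\ y = y'.
Proof.
  intros H; assert (Hs : x + y = x' + y').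
  { destruct (lt_total (x + y) (x' + y')) as [Hs|[Hs|Hs]]; [|exact Hs|].
    - now apply pairing_lt_sum in Hs.
    - symmetry in H; now apply pairing_lt_sum in Hs. }
  unfold pairing in H; rewrite Hs in H; apply add_cancel_l in H; subst x'.
  split; [reflexivity|]; now apply add_cancel_l in Hs.
Qed.

Lemma pow_pos b x : 0 < b -> 0 < b ^ x.
Proof.
  intros Hb; ind (b :: nil) x; [rewrite pow_0; rewrite <- (add_0_l 1); apply lt_succ_diag|].
  intros x H; rewrite pow_succ.
  destruct (zero_or_succ b) as [->|[c ->]]; [now apply lt_irrefl in Hb|].
  destruct (zero_or_succ ((c + 1) ^ x)) as [E|[d E]]; rewrite E in *.
  - now apply lt_irrefl in H.
  - apply lt_iff; exists (c * d + c + d); ring.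
Qed.

Lemma div_lt_unique b q r q' r' :
  r < b -> q * b + r = q' * b + r' -> ~ q < q'.
Proof.
  intros Hr H [z ->]%lt_iff; apply (lt_not_le _ _ Hr).
  apply le_iff; exists (z * b + r').
  apply (add_cancel_l _ _ (q * b)); rewrite H; ring.
Qed.

Lemma div_unique b q r q' r' :
  r < b -> r' < b -> q * b + r = q' * b + r' -> q = q' /\ r = r'.
Proof.
  intros Hr Hr' H; assert (q = q') as <-.
  { destruct (lt_total q q') as [Hq|[Hq|Hq]]; [|exact Hq|].
    - now apply (div_lt_unique b q r q' r') in Hq.
    - now apply (div_lt_unique b q' r' q r) in Hq. }
  split; [reflexivity|]; now apply add_cancel_l in H.
Qed.

(** Uniqueness of division is applied twice, first for the divisor [b ^ j] and then for [b]. *)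
Lemma digit_unique b p j d d' : digit b p j d -> digit b p j d' -> d = d'.
Proof.
  intros [q [_ [r [Hr [Hd E]]]]] [q' [_ [r' [Hr' [Hd' E']]]]].
  rewrite E in E'; apply div_unique in E'; auto.
  destruct E' as [E' _]; apply div_unique in E'; tauto.
Qed.

Lemma digit_intro b p q r j d : 0 < b ->
  r < b ^ j -> d < b -> p = (q * b + d) * b ^ j + r -> digit b p j d.
Proof.
  intros Hb Hr Hd E; exists q; split; [|eauto].
  apply lt_add_1, le_iff.
  assert (Hj := pow_pos b j Hb).
  apply lt_iff in Hb as [b' Hb]; apply lt_iff in Hj as [y Hy].
  rewrite E, Hy, Hb.
  exists (q * b' + d + (q * (0 + b' + 1) + d) * y + r); ring.
Qed.

Lemma digit_0 b x p : x < b -> digit b (x + b * p) 0 x.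
Proof.
  intros Hx; apply digit_intro with p 0; auto.
  - apply le_lt_trans with x; auto using le_0_l.
  - rewrite pow_0, <- (add_0_l 1); apply lt_succ_diag.
  - rewrite pow_0; ring.
Qed.

Lemma add_mul_lt x r b y : x < b -> r < y -> x + b * r < b * y.
Proof.
  intros [u ->]%lt_iff [w ->]%lt_iff; apply lt_iff.
  exists (u + (x + u + 1) * w); ring.
Qed.

Lemma digit_succ b x p j d : x < b -> digit b p j d -> digit b (x + b * p) (j + 1) d.
Proof.
  intros Hx [q [_ [r [Hr [Hd E]]]]].
  (* The prepended digit joins the remainder, which becomes [x + b * r] and stays below
     [b ^ (j + 1)]. *)
  apply digit_intro with q (x + b * r); auto.
  - apply le_lt_trans with x; auto using le_0_l.
  - rewrite pow_succ; now apply add_mul_lt.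
  - rewrite pow_succ, E; ring.
Qed.

(** * The combinatorial argument *)

(** Here and from [interval_in] to [least], the formulas of the theorem are restated as propositions
    about the model, in the same logical shape, so that [sem] can identify the two in the end. *)
Definition function (F : sets M) (A B : D -> Prop) : Prop :=
  (forall p, p ∈ F -> exists x y, p = pairing x y /\ A x /\ B y) /\
  (forall x, A x -> exists y,
    pairing x y ∈ F /\ forall z, pairing x z ∈ F -> z = y).

Lemma function_in F A B x y : function F A B -> pairing x y ∈ F -> A x /\ B y.
Proof.
  intros [H _] Hp; destruct (H _ Hp) as [x' [y' [E H']]].
  apply pairing_inj in E as [<- <-]; exact H'.
Qed.

Lemma function_unique F A B x y z :
  function F A B -> pairing x y ∈ F -> pairing x z ∈ F -> y = z.
Proof.
  intros HF Hy Hz; destruct (proj2 HF x) as [w [_ H]].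
  - now apply (function_in F A B x y HF).
  - now rewrite (H y Hy), (H z Hz).
Qed.

Lemma function_value F A B x : function F A B -> A x -> exists y, pairing x y ∈ F.
Proof. intros [_ H] Hx; destruct (H x Hx) as [y [Hy _]]; eauto. Qed.

Lemma function_intro F A B :
  (forall p, p ∈ F -> exists x y, p = pairing x y /\ A x /\ B y) ->
  (forall x, A x -> exists y, pairing x y ∈ F) ->
  (forall x y z, pairing x y ∈ F -> pairing x z ∈ F -> y = z) ->
  function F A B.
Proof.
  intros H1 H2 H3; split; [exact H1|]; intros x Hx.
  destruct (H2 x Hx) as [y Hy]; exists y; eauto.
Qed.

Notation all := (fun _ : D => True).

(** Bounding for [f] is not directly an instance of induction, since
    [f x <= b] is not bounded in [f x]; comparing the values of [f] with each
    other instead is a Delta-0-1 relation. *)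
Lemma function_bounded f N : function f all all ->
  exists b, forall x y, x < N -> pairing x y ∈ f -> y < b.
Proof.
  intros Hf.
  (* [G] consists of the pairs of arguments below [N] with [f x <= f y]. The Sigma form compares
     values below some [w], the Pi form all values below every [w]; they agree because [f] is
     single-valued and total. *)
  destruct (Delta01_comprehension (N :: nil) (f :: nil)
    (fun p w => exists x, x < N /\ exists y, y < N /\ (p = pairing x y /\
       exists u, u < w /\ exists v, v < w /\
       (pairing x u ∈ f /\ pairing y v ∈ f /\ u <= v)))
    (fun p w => exists x, x < N /\ exists y, y < N /\ (p = pairing x y /\
       forall u, u < w -> forall v, v < w ->
       pairing x u ∈ f -> pairing y v ∈ f -> u <= v))) as [G HG]; [def|def| |].
  { intro p; split.
    - intros [w [x [Hx [y [Hy [-> [u [_ [v [_ [Hu [Hv Huv]]]]]]]]]]]] w'.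
      exists x; split; [exact Hx|]; exists y; split; [exact Hy|]; split; [reflexivity|].
      intros u' _ v' _ Hu' Hv'.
      now rewrite (function_unique _ _ _ _ _ _ Hf Hu' Hu),
        (function_unique _ _ _ _ _ _ Hf Hv' Hv).
    - intros H; destruct (H 0) as [x [Hx [y [Hy [-> _]]]]].
      destruct (function_value _ _ _ x Hf I) as [u Hu].
      destruct (function_value _ _ _ y Hf I) as [v Hv].
      exists (u + v + 1), x; split; [exact Hx|]; exists y; split; [exact Hy|].
      split; [reflexivity|].
      assert (Hu' : u < u + v + 1) by (apply lt_iff; exists v; ring).
      assert (Hv' : v < u + v + 1) by (apply lt_iff; exists u; ring).
      exists u; split; [exact Hu'|]; exists v; split; [exact Hv'|].
      repeat split; auto.
      destruct (H (u + v + 1)) as [x' [_ [y' [_ [E H']]]]].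
      apply pairing_inj in E as [<- <-]; auto. }
  assert (HG' : forall x y u v, x < N -> y < N -> pairing x u ∈ f -> pairing y v ∈ f ->
    (pairing x y ∈ G <-> u <= v)).
  { intros x y u v Hx Hy Hu Hv; rewrite HG; split.
    - intros [_ [x' [_ [y' [_ [E [u' [_ [v' [_ [Hu' [Hv' Huv]]]]]]]]]]]].
      apply pairing_inj in E as [<- <-].
      now rewrite (function_unique _ _ _ _ _ _ Hf Hu Hu'),
        (function_unique _ _ _ _ _ _ Hf Hv Hv').
    - intros Huv; exists (u + v + 1), x; split; [exact Hx|]; exists y.
      split; [exact Hy|]; split; [reflexivity|].
      exists u; split; [apply lt_iff; exists v; ring|].
      exists v; split; [apply lt_iff; exists u; ring|auto]. }
  assert (Hval : forall x, exists u, pairing x u ∈ f)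
    by (intro; now apply (function_value f all all)).
  destruct (Delta00_argmax (N :: nil) (G :: nil) (fun x y => pairing x y ∈ G) N)
    as [->|[i [Hi Hmax]]].
  - def.
  - intros i j Hi Hj; destruct (Hval i) as [u Hu], (Hval j) as [v Hv].
    rewrite (HG' i j u v), (HG' j i v u) by assumption.
    destruct (lt_total u v) as [H|[H|H]]; auto.
  - intros i j k Hi Hj Hk.
    destruct (Hval i) as [u Hu], (Hval j) as [v Hv], (Hval k) as [w Hw].
    rewrite (HG' i j u v), (HG' j k v w), (HG' i k u w) by assumption.
    apply le_trans.
  - exists 0; intros x y Hx; now apply not_lt_0 in Hx.
  - destruct (Hval i) as [b Hb]; exists (b + 1); intros x y Hx Hy.
    apply lt_add_1, (HG' x i y b); auto.
Qed.

Definition interval_in a R n : Prop := a <= n /\ n <= R.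

Definition pairs_in a R p : Prop :=
  exists n m, p = pairing n m /\ a <= n /\ n < m /\ m <= R.

Definition grid_in N c p : Prop := exists i k, p = pairing i k /\ i <= N /\ k < c.

Definition enumeration h H k : Prop :=
  function h (fun i => i < k) (fun x => x ∈ H) /\
  (forall i j x y, i < j -> pairing i x ∈ h -> pairing j y ∈ h -> x < y) /\
  (forall x, x ∈ H -> exists i, pairing i x ∈ h).

Definition weakly_homog C h : Prop :=
  forall i x y z, pairing i x ∈ h -> pairing (i + 1) y ∈ h -> pairing (i + 1 + 1) z ∈ h ->
    exists v, pairing (pairing x y) v ∈ C /\ pairing (pairing y z) v ∈ C.

Definition minimum H m : Prop := m ∈ H /\ forall x, x ∈ H -> m <= x.

Definition wph f c a R : Prop :=
  forall C, function C (pairs_in a R) (fun x => x < c) ->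
    exists H h, exists k m y,
      (forall x, x ∈ H -> interval_in a R x) /\ enumeration h H k /\
      weakly_homog C h /\ minimum H m /\ pairing m y ∈ f /\ y < k.

Definition norm S c i y : Prop :=
  (forall k x, k < c -> pairing (pairing i k) x ∈ S -> x <= y) /\
  ((c = 0 /\ y = 0) \/ exists k, k < c /\ pairing (pairing i k) y ∈ S).

Definition row_le S c i j : Prop :=
  forall k x y, k < c -> pairing (pairing i k) x ∈ S ->
    pairing (pairing j k) y ∈ S -> x <= y.

Definition mdl f c a N : Prop :=
  forall S, function S (grid_in N c) all ->
    (forall i, i <= N -> exists y z, norm S c i y /\ pairing (a + i) z ∈ f /\ y < z) ->
    exists i j, i < j /\ j <= N /\ row_le S c i j.

Definition least (P : D -> Prop) n : Prop := P n /\ forall m, m < n -> ~ P m.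

Lemma mdl_of_wph f c a N : function f all all -> wph f c a (a + N) -> mdl f c a N.
Proof.
  intros Hf HW S HS Hnorm; apply NNPP; intros Hbad.
  destruct (function_bounded f (a + N + 1) Hf) as [b Hb].
  assert (HSb : forall i k, i <= N -> k < c -> exists x, x < b /\ pairing (pairing i k) x ∈ S).
  { intros i k Hi Hk.
    destruct (function_value S _ _ (pairing i k) HS) as [x Hx]; [exists i, k; auto|].
    exists x; split; [|exact Hx].
    destruct (Hnorm i Hi) as [y [z [[Hy _] [Hz Hyz]]]].
    apply le_lt_trans with y; [eauto|]; apply lt_trans with z; [exact Hyz|].
    apply (Hb (a + i)); [|exact Hz]; now apply lt_add_1, add_le_mono_l. }
  (* The entries of row [i] are below [f (a + i)], hence below [b], so a descent in column [k] is a
     bounded condition. *)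
  set (desc := fun i j k => exists x, x < b /\ exists y, y < b /\
    (pairing (pairing i k) x ∈ S /\ pairing (pairing j k) y ∈ S /\ y < x)).
  destruct (Delta00_comprehension (a :: N :: c :: b :: nil) (S :: nil)
    (fun p => exists i, i < N + 1 /\ exists j, j < N + 1 /\ exists k, k < c /\
       (p = pairing (pairing (a + i) (a + j)) k /\ i < j /\ desc i j k /\
        forall k', k' < k -> ~ desc i j k'))) as [C HC]; [unfold desc; def|].
  assert (HCel : forall i j k, pairing (pairing (a + i) (a + j)) k ∈ C <->
    i < j /\ j <= N /\ k < c /\ desc i j k /\ forall k', k' < k -> ~ desc i j k').
  { intros i j k; rewrite HC; split.
    - intros [i' [Hi [j' [Hj [k' [Hk [E H]]]]]]].
      apply pairing_inj in E as [E <-]; apply pairing_inj in E as [E1 E2].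
      apply add_cancel_l in E1, E2; subst i' j'.
      apply lt_add_1 in Hj; tauto.
    - intros [Hij [Hj [Hk H]]]; exists i; split; [|exists j; split; [|exists k; auto]].
      + now apply lt_add_1, (fun H => le_trans i j N (or_introl H)).
      + now apply lt_add_1. }
  assert (HCf : function C (pairs_in a (a + N)) (fun x => x < c)).
  { apply function_intro.
    - intros p Hp; destruct (proj1 (HC p) Hp) as [i [Hi [j [Hj [k [Hk [-> [Hij _]]]]]]]].
      exists (pairing (a + i) (a + j)), k; repeat split; [|exact Hk].
      exists (a + i), (a + j); split; [reflexivity|]; split; [apply le_add_r|].
      split; [now apply add_lt_mono_l|now apply add_le_mono_l, lt_add_1].
    - intros p [n [m [-> [Hn [Hnm Hm]]]]].
      assert (Han : a <= m) by (left; now apply le_lt_trans with n).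
      apply le_iff in Hn as [i ->], Han as [j ->].
      apply add_lt_mono_l in Hnm; apply add_le_mono_l in Hm.
      assert (Hk : exists k, k < c /\ desc i j k).
      { apply NNPP; intros H; apply Hbad; exists i, j; repeat split; auto.
        intros k x y Hk Hx Hy; apply not_lt_le; intros Hyx; apply H; exists k.
        split; [exact Hk|].
        destruct (HSb i k) as [x' [Hx' Hx'']]; [left; now apply lt_le_trans with j|exact Hk|].
        destruct (HSb j k) as [y' [Hy' Hy'']]; [exact Hm|exact Hk|].
        rewrite <- (function_unique _ _ _ _ _ _ HS Hx Hx'') in Hx'.
        rewrite <- (function_unique _ _ _ _ _ _ HS Hy Hy'') in Hy'.
        exists x; split; [exact Hx'|]; exists y; auto. }
      destruct Hk as [k0 Hk0].
      destruct (Delta00_least (i :: j :: b :: c :: nil) (S :: nil)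
        (fun k => k < c /\ desc i j k) k0) as [k [[Hk Hd] Hmin]];
        [unfold desc; def|exact Hk0|].
      exists k; apply HCel; repeat split; auto.
      intros k' Hk' H; apply (Hmin k' Hk'); split; [|exact H].
      now apply lt_trans with k.
    - intros p k k' Hk Hk'.
      destruct (proj1 (HC _) Hk) as [i [_ [j [_ [k1 [_ [E _]]]]]]].
      apply pairing_inj in E as [-> _]; clear k1.
      apply HCel in Hk as [_ [_ [_ [Hd Hmin]]]], Hk' as [_ [_ [_ [Hd' Hmin']]]].
      destruct (lt_total k k') as [H|[H|H]]; [now apply Hmin' in H|exact H|].
      now apply Hmin in H. }
  destruct (HW C HCf) as [H [h [K [m [y [HH [[Hh [Hmono Hsurj]] [Hwh [[Hm Hmin] [Hy HyK]]]]]]]]]].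
  destruct (HH m Hm) as [Ham HmR].
  apply le_iff in Ham as [i0 ->]; apply add_le_mono_l in HmR.
  destruct (Hnorm i0 HmR) as [w [z [Hw [Hz Hwz]]]].
  rewrite (function_unique _ _ _ _ _ _ Hf Hz Hy) in Hwz; clear z Hz.
  (* If the minimum had a positive index, the element of index 0 would be smaller. *)
  assert (Hh0 : pairing 0 (a + i0) ∈ h).
  { destruct (Hsurj _ Hm) as [i Hi]; destruct (le_0_l i) as [H0| ->]; [|exact Hi].
    destruct (function_value h _ _ 0 Hh) as [x Hx].
    { apply lt_trans with i; [exact H0|]; now apply (function_in _ _ _ _ _ Hh) in Hi. }
    assert (HxH := proj2 (function_in _ _ _ _ _ Hh Hx)).
    exfalso; exact (lt_not_le _ _ (Hmono _ _ _ _ H0 Hx Hi) (Hmin x HxH)). }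
  (* Since [w < y < K], the set has at least two elements, hence a color. *)
  apply lt_iff in Hwz as [u ->], HyK as [u' HK].
  assert (EK : K = w + u + u' + 1 + 1) by (rewrite HK; ring).
  (* The last index is [K' + 1], which exceeds the norm [w] of row [i0]. *)
  set (K' := w + u + u') in EK.
  assert (Hlast : K' + 1 < K) by (rewrite EK; apply lt_succ_diag).
  destruct (function_value h _ _ (0 + 1) Hh) as [x1 Hx1].
  { apply le_lt_trans with (K' + 1); [|exact Hlast].
    rewrite !(add_comm _ 1); apply add_le_mono_l, le_0_l. }
  assert (Hedge : forall i x x', pairing i x ∈ h -> pairing (i + 1) x' ∈ h ->
    pairs_in a (a + N) (pairing x x')).
  { intros i x x' Hx Hx'; exists x, x'; split; [reflexivity|].
    split; [|split].
    - apply HH; now apply (function_in _ _ _ _ _ Hh) in Hx.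
    - apply (Hmono i (i + 1)); auto using lt_succ_diag.
    - apply HH; now apply (function_in _ _ _ _ _ Hh) in Hx'. }
  destruct (function_value C _ _ _ HCf (Hedge _ _ _ Hh0 Hx1)) as [k Hk].
  assert (Hkc := proj2 (function_in _ _ _ _ _ HCf Hk)).
  (* Weak homogeneity carries the color [k] of the first edge to all later ones. The bounds on [x]
     and [x'] make this a Sigma-0-0 induction. *)
  assert (Hcolor : forall i, i + 1 < K -> exists x, x < a + N + 1 /\
    exists x', x' < a + N + 1 /\ (pairing i x ∈ h /\ pairing (i + 1) x' ∈ h /\
      pairing (pairing x x') k ∈ C)).
  { assert (Hbd : forall i x, pairing i x ∈ h -> x < a + N + 1).
    { intros i x Hx; apply lt_add_1, HH; now apply (function_in _ _ _ _ _ Hh) in Hx. }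
    Delta00_ind (K :: a :: N :: k :: nil) (h :: C :: nil).
    - intros _; exists (a + i0); split; [eauto|]; exists x1; split; eauto.
    - intros i IH Hi.
      destruct IH as [x [_ [x' [_ [Hx [Hx' Hxk]]]]]].
      { apply lt_trans with (i + 1 + 1); auto using lt_succ_diag. }
      destruct (function_value h _ _ _ Hh Hi) as [x'' Hx''].
      destruct (Hwh _ _ _ _ Hx Hx' Hx'') as [k' [Hk1 Hk2]].
      rewrite <- (function_unique _ _ _ _ _ _ HCf Hxk Hk1) in Hk2.
      exists x'; split; [eauto|]; exists x''; split; [eauto|auto]. }
  destruct (HSb i0 k HmR Hkc) as [V [HV HSV]].
  (* Each edge lowers the entry in column [k] by at least one, starting from [V]; the invariant is
     put as a sum in place of a subtraction. *)
  assert (Hdesc : forall i, i < K -> exists x, x < N + 1 /\ exists v, v < b /\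
    (pairing i (a + x) ∈ h /\ pairing (pairing x k) v ∈ S /\ v + i <= V)).
  { Delta00_ind (K :: a :: N :: k :: b :: V :: nil) (h :: S :: nil).
    - intros _; exists i0; split; [now apply lt_add_1|]; exists V; split; [exact HV|].
      repeat split; auto; right; ring.
    - intros i IH Hi.
      destruct IH as [x [_ [v [_ [Hx [Hv HvV]]]]]].
      { apply lt_trans with (i + 1); auto using lt_succ_diag. }
      destruct (Hcolor i Hi) as [x' [_ [x'' [_ [Hx' [Hx'' Hc]]]]]].
      rewrite <- (function_unique _ _ _ _ _ _ Hh Hx Hx') in Hc; clear x' Hx'.
      assert (Hin : interval_in a (a + N) x'').
      { apply HH; now apply (function_in _ _ _ _ _ Hh) in Hx''. }
      destruct Hin as [[j ->]%le_iff Hj]; apply add_le_mono_l in Hj.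
      apply HCel in Hc as [_ [_ [_ [[v1 [_ [v2 [Hv2b [Hv1 [Hv2 Hlt]]]]]] _]]]].
      rewrite <- (function_unique _ _ _ _ _ _ HS Hv Hv1) in Hlt.
      exists j; split; [now apply lt_add_1|]; exists v2; split; [exact Hv2b|].
      repeat split; auto.
      apply le_trans with (v + i); [|exact HvV].
      apply lt_iff_le in Hlt; apply le_iff in Hlt as [t ->].
      apply le_iff; exists t; ring. }
  (* At the last index the invariant yields [K' + 1 <= V], whereas [V <= w <= K']. *)
  destruct (Hdesc _ Hlast) as [x [_ [v [_ [_ [_ Hle]]]]]].
  apply (lt_irrefl V), lt_le_trans with (v + (K' + 1)); [|exact Hle].
  apply le_lt_trans with w; [now apply (proj1 Hw) with k|].
  apply lt_iff; exists (v + u + u'); unfold K'; ring.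
Qed.

(** [p] codes in base [b] a path x = p_0 < ... < p_l in color [k]. *)
Definition path C a b k x l p : Prop :=
  digit b p 0 x /\
  forall j, j < l -> exists u, u < b /\ exists v, v < b /\
    (digit b p j u /\ digit b p (j + 1) v /\ a <= u /\ u < v /\
     pairing (pairing u v) k ∈ C).

Definition has_path C a b k x l : Prop :=
  a <= x /\ exists p, p < b ^ (l + 1) /\ path C a b k x l p.

Lemma has_path_0 C a b k x : a <= x -> x < b -> has_path C a b k x 0.
Proof.
  intros Ha Hx; split; [exact Ha|]; exists (x + b * 0); split.
  - rewrite pow_succ; apply add_mul_lt; [exact Hx|]; apply pow_pos.
    apply le_lt_trans with x; auto using le_0_l.
  - split; [now apply digit_0|]; intros j Hj; now apply not_lt_0 in Hj.
Qed.

Lemma has_path_cons C a b k x y l :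
  a <= x -> x < y -> pairing (pairing x y) k ∈ C -> y < b ->
  has_path C a b k y l -> has_path C a b k x (l + 1).
Proof.
  intros Ha Hxy HC Hy [_ [p [Hp [Hp0 Hpath]]]].
  assert (Hx : x < b) by now apply lt_trans with y.
  split; [exact Ha|]; exists (x + b * p); split.
  - rewrite pow_succ; now apply add_mul_lt.
  - split; [now apply digit_0|]; intros j Hj.
    destruct (zero_or_succ j) as [->|[i ->]].
    + exists x; split; [exact Hx|]; exists y; split; [exact Hy|].
      repeat split; auto using digit_0, digit_succ.
    + destruct (Hpath i) as [u [Hu [v [Hv [Hiu [Hiv H]]]]]].
      { now apply add_lt_mono_r in Hj. }
      exists u; split; [exact Hu|]; exists v; split; [exact Hv|].
      repeat split; try apply H; now apply digit_succ.
Qed.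

(** [H] is the set of vertices of the path and [h] sends [j] to the digit at position [j]; [l] edges
    have [l + 1] vertices, and all edges have color [k]. *)
Lemma weakly_homog_of_has_path C a b k x l : has_path C a b k x l ->
  exists H h, (forall u, u ∈ H -> a <= u /\ u < b) /\
    enumeration h H (l + 1) /\ weakly_homog C h /\ minimum H x.
Proof.
  intros [Ha [p [_ [Hp0 Hpath]]]].
  destruct (Delta00_comprehension (l :: p :: b :: nil) nil
    (fun u => exists j, j < l + 1 /\ digit b p j u)) as [H HH]; [def|].
  destruct (Delta00_comprehension (l :: p :: b :: nil) nil
    (fun w => exists j, j < l + 1 /\ exists u, u < b /\
      (w = pairing j u /\ digit b p j u))) as [h Hh]; [def|].
  assert (Hb : forall j u, digit b p j u -> u < b).
  { intros j u [q [_ [r [_ [Hu _]]]]]; exact Hu. }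
  assert (Hh' : forall j u, pairing j u ∈ h <-> j < l + 1 /\ digit b p j u).
  { intros j u; rewrite Hh; split.
    - intros [j' [Hj [u' [_ [E H']]]]]; apply pairing_inj in E as [<- <-]; auto.
    - intros [Hj Hu]; exists j; split; [exact Hj|]; exists u; eauto. }
  (* The induction is on the distance [z] of the positions. Bounding [v] by [b], as holds for every
     digit, makes the induction formula Sigma-0-0. *)
  assert (Hmono : forall i z u v, i + z + 1 < l + 1 -> digit b p i u ->
    digit b p (i + z + 1) v -> u < v).
  { intros i z u v Hz Hu Hv; revert Hz v Hv.
    cut (i + z + 1 < l + 1 -> forall v, v < b -> digit b p (i + z + 1) v -> u < v).
    { intros Hc Hz v Hv; eauto. }
    assert (Hstep : forall j u v, j + 1 < l + 1 -> digit b p j u ->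
      digit b p (j + 1) v -> u < v).
    { intros j u1 v1 Hj Hu1 Hv1.
      destruct (Hpath j) as [u2 [_ [v2 [_ [Hu2 [Hv2 [_ [Hlt _]]]]]]]].
      { now apply add_lt_mono_r in Hj. }
      now rewrite (digit_unique _ _ _ _ _ Hu1 Hu2), (digit_unique _ _ _ _ _ Hv1 Hv2). }
    revert z; Delta00_ind (i :: l :: b :: p :: u :: nil) (@nil (sets M)).
    - rewrite add_0_r; intros Hi v _; now apply Hstep.
    - intros z IH Hz v _ Hv; rewrite add_assoc in Hz, Hv.
      destruct (Hpath (i + z + 1)) as [u' [Hub [_ [_ [Hu' _]]]]].
      { now apply add_lt_mono_r in Hz. }
      apply lt_trans with u'; [|now apply (Hstep (i + z + 1))].
      apply IH; auto; apply lt_trans with (i + z + 1 + 1); auto using lt_succ_diag. }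
  assert (Hmono' : forall i j u v, i < j -> j < l + 1 -> digit b p i u ->
    digit b p j v -> u < v).
  { intros i j u v [z ->]%lt_iff; apply Hmono. }
  assert (Hl0 : 0 < l + 1) by apply lt_0_add_1.
  assert (Hmin : forall u, u ∈ H -> x <= u).
  { intros u Hu; apply HH in Hu as [j [Hj Hu]].
    destruct (le_0_l j) as [H0| <-].
    - left; now apply (Hmono' 0 j).
    - right; now apply digit_unique with b p 0. }
  assert (Hdigit : forall j, j < l + 1 -> exists u, digit b p j u).
  { intros j Hj; destruct (zero_or_succ j) as [->|[i ->]]; [eauto|].
    destruct (Hpath i) as [_ [_ [v [_ [_ [Hv _]]]]]]; [|eauto].
    now apply add_lt_mono_r in Hj. }
  exists H, h; split; [|split; [split; [|split]|split; [|split]]].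
  - intros u Hu; split; [now apply le_trans with x; auto|].
    apply HH in Hu as [j [_ Hu]]; eauto.
  - apply function_intro.
    + intros w Hw; destruct (proj1 (Hh w) Hw) as [j [Hj [u [_ [-> Hu]]]]].
      exists j, u; repeat split; auto; apply HH; eauto.
    + intros j Hj; destruct (Hdigit j Hj) as [u Hu]; exists u; now apply Hh'.
    + intros j u v [_ Hu]%Hh' [_ Hv]%Hh'; now apply digit_unique with b p j.
  - intros i j u v Hij [_ Hu]%Hh' [Hj Hv]%Hh'; now apply (Hmono' i j).
  - intros u [j [Hj Hu]]%HH; exists j; now apply Hh'.
  - intros i u v w [_ Hu]%Hh' [_ Hv]%Hh' [Hi Hw]%Hh'.
    apply add_lt_mono_r in Hi.
    destruct (Hpath i) as [u1 [_ [v1 [_ [Hu1 [Hv1 [_ [_ H1]]]]]]]].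
    { apply lt_trans with (i + 1); auto using lt_succ_diag. }
    destruct (Hpath (i + 1) Hi) as [v2 [_ [w2 [_ [Hv2 [Hw2 [_ [_ H2]]]]]]]].
    rewrite (digit_unique _ _ _ _ _ Hu Hu1), (digit_unique _ _ _ _ _ Hw Hw2).
    exists k; split.
    + now rewrite (digit_unique _ _ _ _ _ Hv Hv1).
    + now rewrite (digit_unique _ _ _ _ _ Hv Hv2).
  - apply HH; eauto.
  - exact Hmin.
Qed.

(** [Delta00_argmax] finds a column with a largest entry, the comparison being bounded through [b].
    For [c = 0] it returns no column, and the norm is 0 by convention. *)
Lemma norm_exists S c N b i : function S (grid_in N c) all -> i <= N ->
  (forall k l, pairing (pairing i k) l ∈ S -> l < b) ->
  exists y, norm S c i y.
Proof.
  intros HS Hi Hb.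
  assert (Hval : forall k, k < c -> exists x, pairing (pairing i k) x ∈ S).
  { intros k Hk; apply (function_value S _ _ _ HS); exists i, k; auto. }
  destruct (Delta00_argmax (c :: b :: i :: nil) (S :: nil)
    (fun k k' => forall x, x < b -> forall x', x' < b ->
      pairing (pairing i k) x ∈ S -> pairing (pairing i k') x' ∈ S -> x <= x') c)
    as [->|[k [Hk Hmax]]].
  - def.
  - intros k k' Hk Hk'; destruct (Hval k Hk) as [u Hu], (Hval k' Hk') as [v Hv].
    destruct (le_or_lt u v) as [Huv|Huv]; [left|right]; intros x _ x' _ Hx Hx'.
    + now rewrite (function_unique _ _ _ _ _ _ HS Hx Hu),
        (function_unique _ _ _ _ _ _ HS Hx' Hv).
    + left; now rewrite (function_unique _ _ _ _ _ _ HS Hx Hv),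
        (function_unique _ _ _ _ _ _ HS Hx' Hu).
  - intros k1 k2 k3 _ Hk _ H1 H2 x Hx x' Hx' HSx HSx'.
    destruct (Hval k2 Hk) as [u Hu]; apply le_trans with u; eauto.
  - exists 0; split; [|auto]; intros k x Hk; now apply not_lt_0 in Hk.
  - destruct (Hval k Hk) as [y Hy]; exists y; split; [|eauto].
    intros k' x Hk' Hx; apply (Hmax k' Hk'); eauto.
Qed.

Lemma wph_of_mdl f c a N : function f all all -> mdl f c a N -> wph f c a (a + N).
Proof.
  intros Hf HM' C HC; apply NNPP; intros Hbad.
  destruct (function_bounded f (a + N + 1) Hf) as [b Hb].
  set (B := a + N + 1) in *.
  (* A longer path would give a weakly homogeneous set with minimum [x] and more than [f x]
     elements. *)
  assert (Hlen : forall k x l y, has_path C a B k x l -> pairing x y ∈ f -> l + 1 <= y).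
  { intros k x l y Hp Hy; apply not_lt_le; intros Hlt; apply Hbad.
    destruct (weakly_homog_of_has_path _ _ _ _ _ _ Hp) as [H [h [H1 [H2 [H3 H4]]]]].
    exists H, h, (l + 1), x, y; split; [|auto].
    intros u Hu; split; [|apply lt_add_1]; now apply H1. }
  assert (Hlen' : forall k x l, x < B -> has_path C a B k x l -> l < b).
  { intros k x l Hx Hp; destruct (function_value f _ _ x Hf I) as [y Hy].
    apply lt_trans with y; [|eauto]; apply lt_iff_le; eauto. }
  (* Since path lengths are below [b], being a longest path is a bounded condition; [HSel] then
     drops the bound. *)
  destruct (Delta00_comprehension (a :: N :: c :: b :: B :: nil) (C :: nil)
    (fun p => exists i, i < N + 1 /\ exists k, k < c /\ exists l, l < b /\
      (p = pairing (pairing i k) l /\ has_path C a B k (a + i) l /\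
       forall l', l' < b -> has_path C a B k (a + i) l' -> l' <= l))) as [S HS];
    [clearbody B; unfold has_path, path; def|].
  assert (HB : forall i, i <= N -> a + i < B).
  { intros i Hi; now apply lt_add_1, add_le_mono_l. }
  assert (HSel : forall i k l, pairing (pairing i k) l ∈ S <->
    i <= N /\ k < c /\ has_path C a B k (a + i) l /\
    forall l', has_path C a B k (a + i) l' -> l' <= l).
  { intros i k l; rewrite HS; split.
    - intros [i' [Hi [k' [Hk [l' [Hl [E [H1 H2]]]]]]]].
      apply pairing_inj in E as [E <-]; apply pairing_inj in E as [<- <-].
      apply lt_add_1 in Hi; split; [exact Hi|]; split; [exact Hk|]; split; [exact H1|].
      intros l' H'; apply H2; [exact (Hlen' _ _ _ (HB _ Hi) H')|exact H'].
    - intros [Hi [Hk [H1 H2]]]; exists i; split; [now apply lt_add_1|].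
      exists k; split; [exact Hk|]; exists l; split; [|auto].
      exact (Hlen' _ _ _ (HB _ Hi) H1). }
  assert (HSf : function S (grid_in N c) all).
  { apply function_intro.
    - intros p Hp; destruct (proj1 (HS p) Hp) as [i [Hi [k [Hk [l [_ [-> _]]]]]]].
      exists (pairing i k), l; repeat split.
      exists i, k; repeat split; auto; now apply lt_add_1.
    - intros p [i [k [-> [Hi Hk]]]].
      destruct (Delta00_greatest (a :: i :: k :: b :: B :: nil) (C :: nil)
        (fun l => has_path C a B k (a + i) l) b 0) as [l [Hl Hmax]].
      + clearbody B; unfold has_path, path; def.
      + apply has_path_0; auto using le_add_r.
      + intros l Hl; left; eauto.
      + exists l; now apply HSel.
    - intros p l l' Hl Hl'.
      destruct (proj1 (HS _) Hl) as [i [_ [k [_ [l1 [_ [E _]]]]]]].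
      apply pairing_inj in E as [-> _].
      apply HSel in Hl as [_ [_ [Hl Hmax]]], Hl' as [_ [_ [Hl' Hmax']]].
      apply le_antisym; auto. }
  destruct (HM' S HSf) as [i [j [Hij [Hj Hle]]]].
  { intros i Hi.
    destruct (norm_exists S c N b i HSf Hi) as [y Hy].
    { intros k l Hl; apply HSel in Hl as [_ [_ [Hl _]]]; eauto. }
    destruct (function_value f _ _ (a + i) Hf I) as [z Hz].
    exists y, z; repeat split; try apply Hy; auto.
    apply lt_iff_le; destruct Hy as [_ [[_ ->]|[k [_ Hk]]]].
    - apply (Hlen 0 (a + i)); auto; apply has_path_0; auto using le_add_r.
    - apply HSel in Hk as [_ [_ [Hk _]]]; eauto. }
  assert (Hi : i <= N) by (left; now apply lt_le_trans with j).
  destruct (function_value C _ _ (pairing (a + i) (a + j)) HC) as [k Hk].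
  { exists (a + i), (a + j); split; [reflexivity|]; split; [apply le_add_r|].
    split; [now apply add_lt_mono_l|now apply add_le_mono_l]. }
  assert (Hkc := proj2 (function_in _ _ _ _ _ HC Hk)).
  destruct (function_value S _ _ (pairing i k) HSf) as [l Hl]; [exists i, k; auto|].
  destruct (function_value S _ _ (pairing j k) HSf) as [l' Hl']; [exists j, k; auto|].
  assert (Hll := Hle k l l' Hkc Hl Hl').
  apply HSel in Hl as [_ [_ [_ Hmax]]], Hl' as [_ [_ [Hl' _]]].
  (* Prepending the edge to a longest path from [a + j] gives [l' + 1 <= l], against [l <= l']. *)
  apply (lt_irrefl l), le_lt_trans with l'; [exact Hll|].
  apply lt_iff_le, Hmax, has_path_cons with (a + j); auto using le_add_r.
  now apply add_lt_mono_l.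
Qed.

(** For [R < a] the empty set is a coloring, but no set within the empty interval has a minimum. *)
Lemma wph_le f c a R : wph f c a R -> a <= R.
Proof.
  intros HW; apply not_lt_le; intros HR.
  destruct (Delta00_comprehension nil nil (fun _ => False)) as [C HC]; [def|].
  destruct (HW C) as [H [h [_ [m [_ [HH [_ [_ [[Hm _] _]]]]]]]]].
  - split; [intros p Hp; now apply HC in Hp|].
    intros p [n [m [_ [Hn [Hnm Hm]]]]]; exfalso.
    apply (lt_not_le _ _ HR), le_trans with n; [exact Hn|].
    left; now apply lt_le_trans with m.
  - destruct (HH m Hm) as [H1 H2]; exact (lt_not_le _ _ HR (le_trans _ _ _ H1 H2)).
Qed.

(** Minimality carries over because, by [wph_le], every candidate below [a + N] has the form
    [a + n]. *)
Lemma least_wph_iff f c a N : function f all all ->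
  (least (wph f c a) (a + N) <-> least (mdl f c a) N).
Proof.
  intros Hf; split; intros [H Hmin]; split; auto using mdl_of_wph, wph_of_mdl.
  - intros m Hm H'; apply (Hmin (a + m)); auto using wph_of_mdl.
    now apply add_lt_mono_l.
  - intros m Hm H'.
    destruct (proj1 (le_iff a m) (wph_le _ _ _ _ H')) as [n ->].
    apply add_lt_mono_l in Hm; apply (Hmin n Hm); now apply mdl_of_wph.
Qed.

Lemma least_unique P m n : least P m -> least P n -> m = n.
Proof.
  intros [Hm Hm'] [Hn Hn']; destruct (lt_total m n) as [H|[H|H]]; auto.
  - now apply Hn' in H.
  - now apply Hm' in H.
Qed.

Lemma corollary10_in_model a c f : function f all all ->
  ((exists R, least (wph f c a) R) <-> (exists N, least (mdl f c a) N)) /\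
  (forall R N, least (wph f c a) R -> least (mdl f c a) N -> R = N + a).
Proof.
  intros Hf; split; [split|].
  - intros [R HR].
    destruct (proj1 (le_iff a R) (wph_le _ _ _ _ (proj1 HR))) as [N ->].
    exists N; now apply least_wph_iff.
  - intros [N HN]; exists (a + N); now apply least_wph_iff.
  - intros R N HR HN; rewrite (add_comm N).
    apply least_unique with (wph f c a); [exact HR|now apply least_wph_iff].
Qed.

End Model.

Theorem corollary10 :
  RCA0star ⊢ sentence
    (∀ a c, ∀² f, is_fun f cN cN →
       ((∃ R, is_R f c a R) ↔ (∃ D, is_D f c a D)) ∧
       (∀ R D, is_R f c a R → is_D f c a D → R = D + a))%fm.
Proof.
  apply completeness; [exact RCA0star_subst_closed|]; intros M HM e v.
  generalize (corollary10_in_model M HM v).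
  unfold least, mdl, wph, row_le, norm, minimum, weakly_homog, enumeration,
    grid_in, pairs_in, interval_in, function, pairing.
  (* The named binders are computed away while the defined connectives stay folded, so that [sem]
     can compare the sentence with the proposition. *)
  match goal with |- ?P -> eval _ _ _ ?p =>
    let p' := eval cbv -[Top And Or Iff ExN ExS Neg] in p in
    change (P -> eval M e v p');
    cut (eval M e v p' <-> P); [intros [_ H]; exact H|]
  end.
  sem.
Qed.
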